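(* Let $I$ be a Samelson complex structure on a compact semi-simple Lie group $G$, determined by a maximal torus $T$ (and a choice of positive roots and of a complex structure on $\mathfrak t$), and let $g$ be a left-invariant CYT $I$-Hermitian metric on $G$. Then there is a left-invariant CYT $I$-Hermitian metric on $(G,I)$ which is also right $T$-invariant.
   Context: Samelson complex structure: let $G$ have even rank, let $T\subset G$ be a maximal torus with Lie algebra $\mathfrak t$, $\mathfrak h=\mathfrak t^{c}$, and $\mathfrak g^{c}=\mathfrak h\oplus\bigoplus_{\alpha\in\Phi}\mathfrak g_\alpha$ the root space decomposition of the complexified Lie algebra of $G$. A choice of a system of positive roots $P\subset\Phi$ and of a linear endomorphism of $\mathfrak t$ with square $-\mathrm{Id}$ determines a left-invariant complex structure $I$ on $G$: $I|_{\mathfrak t}$ is this endomorphism, and $I$ acts as multiplication by $\mathrm{i}$ on $\mathfrak g_\alpha$ and by $-\mathrm{i}$ on $\mathfrak g_{-\alpha}$ for $\alpha\in P$. The Bismut connection $\nabla^{B}$ of a Hermitian manifold $(M,I,g)$ of complex dimension $n$ is the unique connection preserving $g$ and $I$ whose torsion is totally skew-symmetric. The metric $g$ is CYT (Calabi--Yau with torsion, or Bismut--Ricci flat) if the restricted holonomy of $\nabla^{B}$ is contained in $\mathrm{SU}(n)$, equivalently the Ricci form of $\nabla^{B}$ vanishes. ''Right $T$-invariant'' means invariant under the right translations of $G$ by elements of $T$. *)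

(* Defs.v *)
From HB Require Import structures.
From mathcomp Require Import all_boot all_order all_algebra.
From mathcomp Require Import complex.
From mathcomp Require Import all_classical all_reals all_analysis.

Set Implicit Arguments.
Unset Strict Implicit.
Unset Printing Implicit Defensive.

Import Order.TTheory GRing.Theory Num.Theory.
Import numFieldNormedType.Exports.

Local Open Scope classical_set_scope.
Local Open Scope ring_scope.

(** * Lie groups *)

Fixpoint Ck (R : realType) (V W : normedModType R) (k : nat) (U : set V)
    (f : V -> W) : Prop :=
  match k with
  | 0%N => forall x, U x -> {for x, continuous f}
  | k'.+1 => (forall x, U x -> differentiable f x) /\
             (forall v, Ck k' U (fun x => 'd f x v))
  end.

(* Only used for open U. *)
Definition smooth_on (R : realType) (V W : normedModType R) (U : set V)
    (f : V -> W) : Prop := forall k, Ck k U f.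

(* A d-dimensional Lie group: a Hausdorff topological group with a chart
   centred at the identity whose left translates, the charts
   x |-> chart (a^-1 * x) for a in G, form a smooth atlas in which the
   multiplication and the inversion are smooth.  The compatibility of the charts
   of the atlas is the case b = 1, v = 0 of [lie_smooth_mul].  Every Lie group is
   of this form, for any chart of its smooth structure centred at 1. *)
HB.mixin Record isLieGroup (R : realType) (d : nat) G
    of Topological G & Group G := {
  lie_hausdorff : hausdorff_space G ;
  lie_continuous_mul : continuous (fun p : G * G => (p.1 * p.2)%g) ;
  lie_continuous_inv : continuous (fun x : G => x^-1%g) ;
  chart_dom : set G ;
  chart : G -> 'rV[R]_d ;
  chart_inv : 'rV[R]_d -> G ;
  chart_dom_open : open chart_dom ;
  chart_dom1 : chart_dom 1%g ;
  chart_img_open : open (chart @` chart_dom) ;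
  chart1 : chart 1%g = 0 ;
  chartK : forall x, chart_dom x -> chart_inv (chart x) = x ;
  chart_continuous : forall x, chart_dom x -> {for x, continuous chart} ;
  chart_inv_continuous : forall u, (chart @` chart_dom) u ->
    {for u, continuous chart_inv} ;
  lie_smooth_mul : forall a b c : G,
    smooth_on
      [set p : 'rV[R]_d * 'rV[R]_d | [/\ (chart @` chart_dom) p.1,
         (chart @` chart_dom) p.2 &
         chart_dom (c^-1 * ((a * chart_inv p.1) * (b * chart_inv p.2)))%g]]
      (fun p => chart (c^-1 * ((a * chart_inv p.1) * (b * chart_inv p.2)))%g) ;
  lie_smooth_inv : forall a c : G,
    smooth_on
      [set u : 'rV[R]_d | (chart @` chart_dom) u /\
         chart_dom (c^-1 * (a * chart_inv u)^-1)%g]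
      (fun u => chart (c^-1 * (a * chart_inv u)^-1)%g)
}.

#[short(type="lieGroupType")]
HB.structure Definition LieGroup (R : realType) (d : nat) :=
  { G of isLieGroup R d G & Topological G & Group G }.

Section Calculus.
Variables (R : realType) (d : nat) (G : lieGroupType R d).

(* The tangent space of G at x is 'rV[R]_d, through the chart
   y |-> chart (x^-1 * y) centred at x; this identification is the left
   trivialization of TG, so constant functions G -> 'rV[R]_d are exactly the
   left-invariant vector fields. *)

(* Differential at x of f : G -> W. *)
Definition dfun (W : normedModType R) (f : G -> W) (x : G) (v : 'rV[R]_d) : W :=
  'd (fun u : 'rV[R]_d => f (x * chart_inv u)%g) 0 v.

(* Tangent map T_x G -> T_(f x) G of f : G -> G. *)
Definition tmap (f : G -> G) (x : G) (v : 'rV[R]_d) : 'rV[R]_d :=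
  dfun (fun y => chart ((f x)^-1 * f y)%g) x v.

Definition smooth_field (W : normedModType R) (f : G -> W) : Prop :=
  forall a, smooth_on (chart @` @chart_dom R d G)
                      (fun u => f (a * chart_inv u)%g).

(** * The Lie algebra of G *)

Definition Ad (a : G) (v : 'rV[R]_d) : 'rV[R]_d :=
  tmap (fun x => (a * x * a^-1)%g) 1%g v.

(* ad is the differential of Ad at the identity. *)
Definition lie_bracket (u v : 'rV[R]_d) : 'rV[R]_d :=
  dfun (fun a => Ad a v) 1%g u.

Definition killing_form (u v : 'rV[R]_d) : R :=
  \tr (lin1_mx (lie_bracket u) *m lin1_mx (lie_bracket v)).

Definition semisimple : Prop :=
  forall u, (forall v, killing_form u v = 0) -> u = 0.

(** * Maximal tori *)

Definition is_subgroup (T : set G) : Prop :=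
  [/\ T 1%g, (forall x y, T x -> T y -> T (x * y)%g) &
      (forall x, T x -> T x^-1%g)].

(* A compact subgroup of a Lie group is closed, hence a Lie subgroup. *)
Definition torus (T : set G) : Prop :=
  [/\ is_subgroup T, compact T, connected T &
      (forall x y, T x -> T y -> (x * y = y * x)%g)].

Definition maximal_torus (T : set G) : Prop :=
  torus T /\ (forall T' : set G, torus T' -> T `<=` T' -> T' = T).

(* T_1 T, as the set of velocities at 1 of the curves in T.  Continuity at 0
   makes the curve stay in the domain of the chart near 0. *)
Definition lie_subalg (T : set G) : set 'rV[R]_d :=
  [set X | exists gamma : R -> G,
     [/\ gamma 0 = 1%g, (forall s, T (gamma s)), {for 0, continuous gamma} &
         is_derive (0 : R) (1 : R) (fun s => chart (gamma s)) X]].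

(** * Roots and Samelson complex structures *)

(* An element X + iY of the complexified Lie algebra is a row vector over R[i]. *)
Definition cvec (X Y : 'rV[R]_d) : 'rV[R[i]]_d :=
  \row_j (X 0 j +i* Y 0 j)%C.

Definition re_vec (Z : 'rV[R[i]]_d) : 'rV[R]_d := map_mx (@complex.Re R) Z.
Definition im_vec (Z : 'rV[R[i]]_d) : 'rV[R]_d := map_mx (@complex.Im R) Z.

Definition lie_bracketC (Z W : 'rV[R[i]]_d) : 'rV[R[i]]_d :=
  cvec (lie_bracket (re_vec Z) (re_vec W) - lie_bracket (im_vec Z) (im_vec W))
       (lie_bracket (re_vec Z) (im_vec W) + lie_bracket (im_vec Z) (re_vec W)).

(* h = t^c *)
Definition cartan (T : set G) : set 'rV[R[i]]_d :=
  [set H | lie_subalg T (re_vec H) /\ lie_subalg T (im_vec H)].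

(* A complex linear functional on h = t^c is given by its values on t. *)
Definition weight (T : set G) : Type := set_type (lie_subalg T) -> R[i].

Definition root_space (T : set G) (a : weight T) : set 'rV[R[i]]_d :=
  [set Z | forall H : set_type (lie_subalg T),
     lie_bracketC (cvec (\val H) 0) Z = a H *: Z].

(* A functional with a nonzero eigenvector is automatically linear. *)
Definition is_root (T : set G) (a : weight T) : Prop :=
  (exists H, a H != 0) /\ (exists2 Z, root_space a Z & Z != 0).

(* g^c is the sum of h and of the root spaces; as h is abelian, this sum of joint
   eigenspaces for distinct weights is automatically direct.  Every maximal torus
   of a compact Lie group has this property. *)
Definition root_space_decomposition (T : set G) : Prop :=
  forall Z : 'rV[R[i]]_d,
    exists H : 'rV[R[i]]_d, exists n : nat,
    exists a : 'I_n -> weight T, exists F : 'I_n -> 'rV[R[i]]_d,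
    [/\ cartan T H, (forall j, is_root (a j) /\ root_space (a j) (F j)) &
        Z = H + \sum_(j < n) F j].

Definition positive_system (T : set G) (P : set (weight T)) : Prop :=
  [/\ (forall a, P a -> is_root a),
      (forall a, is_root a -> P a \/ P (\- a)),
      (forall a, ~ (P a /\ P (\- a))) &
      (forall a b, P a -> P b -> is_root (a \+ b) -> P (a \+ b))].

(* Fields of endomorphisms and of bilinear forms are matrix-valued in the left
   trivialization; endomorphisms act on row vectors by right multiplication. *)
Definition bilin (B : 'M[R]_d) (u v : 'rV[R]_d) : R := (u *m B *m v^T) 0 0.

Definition left_invariant_endo (I : G -> 'M[R]_d) : Prop :=
  forall a x v,
    tmap (fun y => (a * y)%g) x v *m I (a * x)%g =
    tmap (fun y => (a * y)%g) x (v *m I x).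

Definition samelson (T : set G) (P : set (weight T)) (I : G -> 'M[R]_d) : Prop :=
  let IC : 'M[R[i]]_d := map_mx (real_complex R) (I 1%g) in
  [/\ left_invariant_endo I,
      (forall X, lie_subalg T X ->
         lie_subalg T (X *m I 1%g) /\ X *m I 1%g *m I 1%g = - X),
      (forall a Z, P a -> root_space a Z -> Z *m IC = (0 +i* 1)%C *: Z) &
      (forall a Z, P a -> root_space (\- a) Z -> Z *m IC = - ((0 +i* 1)%C *: Z))].

(** * Hermitian metrics *)

Definition riemannian_metric (g : G -> 'M[R]_d) : Prop :=
  [/\ smooth_field g,
      (forall x u v, bilin (g x) u v = bilin (g x) v u) &
      (forall x u, u != 0 -> 0 < bilin (g x) u u)].

Definition hermitian_metric (I g : G -> 'M[R]_d) : Prop :=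
  riemannian_metric g /\
  (forall x u v, bilin (g x) (u *m I x) (v *m I x) = bilin (g x) u v).

(* g is invariant under the diffeomorphism f. *)
Definition invariant_under (g : G -> 'M[R]_d) (f : G -> G) : Prop :=
  forall x u v, bilin (g (f x)) (tmap f x u) (tmap f x v) = bilin (g x) u v.

Definition left_invariant_metric (g : G -> 'M[R]_d) : Prop :=
  forall a, invariant_under g (fun x => (a * x)%g).

Definition right_T_invariant (T : set G) (g : G -> 'M[R]_d) : Prop :=
  forall t, T t -> invariant_under g (fun x => (x * t)%g).

(** * The Bismut connection *)

(* A connection on TG is its family of connection matrices Gamma in the left
   trivialization: for a vector field Y and a tangent vector u at x,
   nabla_u Y = dY(u) + Y(x) Gamma_x(u). *)
Definition connection := G -> {linear 'rV[R]_d -> 'M[R]_d}.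

Definition nabla (Gamma : connection) (u : 'rV[R]_d) (Y : G -> 'rV[R]_d)
    (x : G) : 'rV[R]_d := dfun Y x u + Y x *m Gamma x u.

Definition smooth_connection (Gamma : connection) : Prop :=
  forall u, smooth_field (fun x => Gamma x u).

(* The tensors below are evaluated on left-invariant vector fields u, v, w, i.e.
   on the constant functions [cst u], [cst v], [cst w]; the vector field [u, v] is
   the left-invariant field [lie_bracket u v]. *)
Definition torsion (Gamma : connection) (x : G) (u v : 'rV[R]_d) : 'rV[R]_d :=
  nabla Gamma u (cst v) x - nabla Gamma v (cst u) x - lie_bracket u v.

Definition curvature (Gamma : connection) (x : G) (u v w : 'rV[R]_d)
  : 'rV[R]_d :=
  nabla Gamma u (nabla Gamma v (cst w)) x -
  nabla Gamma v (nabla Gamma u (cst w)) x -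
  nabla Gamma (lie_bracket u v) (cst w) x.

Definition preserves_metric (Gamma : connection) (g : G -> 'M[R]_d) : Prop :=
  forall x u v w,
    dfun (fun y => bilin (g y) v w) x u =
    bilin (g x) (nabla Gamma u (cst v) x) w +
    bilin (g x) v (nabla Gamma u (cst w) x).

Definition preserves_endo (Gamma : connection) (I : G -> 'M[R]_d) : Prop :=
  forall x u v,
    nabla Gamma u (fun y => v *m I y) x = nabla Gamma u (cst v) x *m I x.

(* Antisymmetry of g(torsion(u, v), w) in (u, v) always holds. *)
Definition skew_torsion (Gamma : connection) (g : G -> 'M[R]_d) : Prop :=
  forall x u v w,
    bilin (g x) (torsion Gamma x u v) w = - bilin (g x) (torsion Gamma x u w) v.

Definition bismut_connection (I g : G -> 'M[R]_d) (Gamma : connection) : Prop :=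
  [/\ smooth_connection Gamma, preserves_metric Gamma g,
      preserves_endo Gamma I & skew_torsion Gamma g].

(* rho(u, v) = 1/2 sum_i g(R(u, v) e_i, I e_i) for an orthonormal frame (e_i),
   that is, -1/2 the trace of w |-> I R(u, v) w. *)
Definition ricci_form (Gamma : connection) (I : G -> 'M[R]_d) (x : G)
    (u v : 'rV[R]_d) : R :=
  - (2^-1 * \tr (lin1_mx (fun w => curvature Gamma x u v w *m I x))).

(* The Bismut connection is unique, so "exists" is "the". *)
Definition cyt (I g : G -> 'M[R]_d) : Prop :=
  exists2 Gamma : connection, bismut_connection I g Gamma &
    forall x u v, ricci_form Gamma I x u v = 0.

End Calculus.

(* Main.v *)
Require Import Defs.
From HB Require Import structures.
From mathcomp Require Import all_boot all_order all_algebra.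
From mathcomp Require Import ring lra complex.
From mathcomp Require Import all_classical all_reals all_analysis.

(** The idea is to average the inverse metric rather than the metric.

    Everything is left-invariant, hence determined on the Lie algebra.  In the left
    trivialization the Bismut connection of a left-invariant Hermitian metric [g] is
    a constant linear map [Gamma] (by uniqueness, [bismut_form_unique]) that commutes
    with [I], so its Ricci form is [2^-1 tr (Gamma_[u, v] I)]
    ([ricci_left_invariant]).  A semisimple Lie algebra is spanned by brackets
    ([killing_perfect]), and [g] is CYT exactly when [tr (Gamma_w I) = 0] for all
    [w].  The torsion equations compute this trace ([bismut_trace]):
    [tr (Gamma_w I) = eta w + g(sum_i [e_i, I e_i], w)] for a [g]-orthonormal basis
    [e_i], where [eta w = tr (ad_w I) + tr (ad_(I w))] depends on [I] only.  Written
    with [h = g^-1] the CYT condition is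
    [sum_(i, j) h_(i, j) [x_i, I x_j] + eta h = 0], a linear condition on [h]
    ([cyt_defect], [cyt_defect_trace]).

    The torus acts on inverse metrics through [Ad].  An element of [T] acts trivially
    on the Lie algebra of [T] and preserves every root space, where [I] is a scalar;
    so [Ad t] commutes with [I] ([Ad_J]), and the action preserves the linear
    condition ([cyt_defect_aut]), symmetry and [I]-invariance.  As [T] is compact,
    [Ad] of [T] is a bounded group of matrices, and a bounded group that preserves a
    nonempty closed convex set has a fixed point in it
    ([bounded_group_fixed_point], [invariant_bivector]).  The inverse of the fixed
    point is the required metric: in the left trivialization a right translation by
    [t] acts as [Ad t^-1] ([tmap_right]).

    For the new metric a Bismut connection has to be exhibited
    ([bismut_form_exists]); this uses that [I] is integrable, which follows from the
    closure of the positive roots under addition ([samelson_integrable]).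

    The Lie algebra is obtained from the group by differentiating twice.  [Ad] is
    differentiable at the identity ([Ad_chart_differentiable]), and differentiating
    its multiplicativity gives the Leibniz identity of the bracket
    ([lie_bracket_leibniz]).  Then [[u, u]] acts trivially and is zero because the
    Killing form is nondegenerate, so that the bracket is antisymmetric
    ([leibniz_antisymmetric]). *)

Set Implicit Arguments.
Unset Strict Implicit.
Unset Printing Implicit Defensive.

Import Order.TTheory GRing.Theory Num.Theory.
Import numFieldNormedType.Exports.

Local Open Scope classical_set_scope.
Local Open Scope ring_scope.

(** * Differentials *)

Section Diff.
Variable R : realType.

(** The difference of the two functions vanishes near [x], hence is a little-o of
    any order. *)
Lemma near_eq_is_diff (V W : normedModType R) (f g df : V -> W) (x : V) :
  (\forall y \near x, f y = g y) -> is_diff x f df -> is_diff x g df.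
Proof.
move=> fg fdf.
suff z0 : is_diff x (g - f) (0 : V -> W).
  have -> : g = f + (g - f) by apply/funext => y /=; rewrite !fctE addrC subrK.
  have := @is_diffD _ _ _ f (g - f) df 0 x fdf z0.
  by rewrite addr0.
have near0 : (g - f) \o shift x =
    cst ((g - f) x) + (0 : V -> W) +o_ (0 : V) id.
  apply/eqaddoP => e e0 /=.
  have H : \forall y \near (0 : V), f (y + x) = g (y + x).
    have := fg; rewrite (near_shift 0) subr0 => H; apply: filterS H => y /=.
    by [].
  apply: filterS H => y H.
  have -> : ((g - f) \o +%R^~ x - (cst ((g - f) x) + 0)) y =
    (g (y + x) - f (y + x)) - ((g x - f x) + 0) by [].
  by rewrite H (nbhs_singleton fg) !subrr addr0 subrr normr0 mulr_ge0 // ltW.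
have d0 : 'd (g - f) x = (0 : V -> W) :> (V -> W).
  by apply: (diff_unique (df := \0)) => //; exact: cst_continuous.
apply: DiffDef => //; apply/diff_locallyP; rewrite d0; split => //.
exact: cst_continuous.
Qed.

Lemma linear_rV_continuous n (W : normedModType R)
  (f : {linear 'rV[R]_n -> W}) : continuous f.
Proof.
have -> : f = (fun v => \sum_(j < n) v 0 j *: f (delta_mx 0 j)) :> (_ -> _).
  apply/funext => v; rewrite {1}(row_sum_delta v) linear_sum.
  by apply: eq_bigr => j _; rewrite linearZ.
move=> v; apply: differentiable_continuous.
suff -> : (fun v : 'rV[R]_n => \sum_(j < n) v 0 j *: f (delta_mx 0 j)) =
   \sum_(j < n) (fun v : 'rV[R]_n => v 0 j *: f (delta_mx 0 j)).
  apply: differentiable_sum => j; apply: differentiableZl.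
  exact: differentiable_coord.
by apply/funext => w; rewrite fct_sumE.
Qed.

Lemma is_diff_linear_rV n (W : normedModType R)
  (f : {linear 'rV[R]_n -> W}) x : is_diff x f f.
Proof.
have c := @linear_rV_continuous n W f.
by apply: DiffDef; [exact: linear_differentiable | exact: diff_lin].
Qed.

Lemma is_diff_linear_fun n (W : normedModType R) (f : 'rV[R]_n -> W) x :
  linear f -> is_diff x f f.
Proof.
move=> lf; pose lM := GRing.isLinear.Build _ _ _ _ _ lf.
pose fL : {linear _ -> _} := HB.pack f lM.
exact: (@is_diff_linear_rV _ _ fL).
Qed.

Lemma is_diff_coord n (x : 'rV[R]_n) j :
  is_diff x (fun M : 'rV[R]_n => M 0 j) (fun M : 'rV[R]_n => M 0 j).
Proof.
by apply: (@is_diff_linear_fun _ R^o) => a u v; rewrite !mxE.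
Qed.

Lemma is_diff_mulmx n m (M : 'M[R]_(n, m)) (x : 'rV[R]_n) :
  is_diff x (mulmxr M) (mulmxr M).
Proof. exact: is_diff_linear_rV. Qed.

Lemma is_diff_unique (V W : normedModType R) (f df dg : V -> W) (x : V) :
  is_diff x f df -> is_diff x f dg -> df = dg.
Proof. by move=> [_ <-] [_ <-]. Qed.

(** The product rule is reduced to real functions, coordinate by coordinate. *)
Lemma is_diffZv (V : normedModType R) n (k dk : V -> R) (f df : V -> 'rV[R]_n) (x : V) :
  is_diff x k dk -> is_diff x f df ->
  is_diff x (fun y => k y *: f y) (fun v => dk v *: f x + k x *: df v).
Proof.
move=> hk hf.
have E (F : V -> 'rV[R]_n) : F = \sum_(j < n) (fun y => F y 0 j *: delta_mx 0 j).
  by apply/funext => y; rewrite fct_sumE [LHS](row_sum_delta (F y)).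
have hfj j : is_diff x (fun y => f y 0 j) (fun v => df v 0 j).
  have hc := is_diff_coord (f x) j.
  exact: (@is_diff_comp _ _ _ _ _ _ _ _ _ hf hc).
have D : differentiable (fun y => k y *: f y) x.
  rewrite (E (fun y => k y *: f y)); apply: differentiable_sum => j.
  apply: (@differentiableZl _ _ _ (fun y => (k y *: f y) 0 j)).
  have -> : (fun y => (k y *: f y) 0 j) = k * (fun y => f y 0 j).
    by apply/funext => y; rewrite mxE.
  apply: differentiableM; exact: ex_diff.
apply: DiffDef => //; apply/funext => v.
apply/rowP => j.
have hc := is_diff_coord (k x *: f x) j.
have H1 := (@is_diff_comp _ _ _ _ _ _ _ _ _ (differentiableP D) hc).
have hkf := @is_diffM _ _ _ _ _ _ _ hk (hfj j).
have H2 : is_diff x ((fun M : 'rV[R]_n => M 0 j : R) \o (fun y => k y *: f y))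
   (k x *: (fun v : V => df v 0 j) + f x 0 j *: dk).
  have <- // : k * (fun y => f y 0 j) = ((fun M : 'rV[R]_n => M 0 j : R) \o (fun y => k y *: f y)).
  by apply/funext => y; rewrite /= mxE.
have /= -> := congr1 (@^~ v) (is_diff_unique H1 H2).
by rewrite !mxE !fctE addrC /=; congr (_ + _); rewrite mulrC.
Qed.

Lemma is_diff_sum (V W : normedModType R) n (f df : 'I_n -> V -> W) (x : V) :
  (forall j, is_diff x (f j) (df j)) ->
  is_diff x (\sum_(j < n) f j) (\sum_(j < n) df j).
Proof.
move=> h; elim/big_ind2 : _ => // [|g dg k dk]; first exact: is_diff_cst.
exact: is_diffD.
Qed.

Lemma is_diff_compE (U V W : normedModType R) (f df : U -> V) (g dg : V -> W) x :
  is_diff x f df -> forall y, f x = y -> is_diff y g dg ->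
  is_diff x (fun y => g (f y)) (fun v => dg (df v)).
Proof. by move=> hf y <-; exact: is_diff_comp. Qed.

End Diff.

(** * Charts and the adjoint representation *)

Section LieGroup.
Variables (R : realType) (d : nat) (G : lieGroupType R d).
Local Notation phi := (@chart R d G).
Local Notation psi := (@chart_inv R d G).
Local Notation dom := (@chart_dom R d G).

Lemma chart_inv0 : psi 0 = 1%g.
Proof. by rewrite -(@chart1 R d G) chartK //; exact: chart_dom1. Qed.

Lemma chart_invK u : (phi @` dom) u -> dom (psi u) /\ phi (psi u) = u.
Proof. by case=> x Dx <-; rewrite chartK. Qed.

Lemma chart_img0 : (phi @` dom) 0.
Proof. by exists 1%g; [exact: chart_dom1 | exact: chart1]. Qed.

Lemma near_chart_img : \forall u \near (0 : 'rV[R]_d), (phi @` dom) u.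
Proof. exact: open_nbhs_nbhs (conj (@chart_img_open R d G) chart_img0). Qed.

Lemma near_chart_dom : \forall x \near (1%g : G), dom x.
Proof. exact: open_nbhs_nbhs (conj (@chart_dom_open R d G) (@chart_dom1 R d G)). Qed.

Lemma chart_inv_cvg0 : psi u @[u --> (0 : 'rV[R]_d)] --> (1%g : G).
Proof. rewrite -chart_inv0; exact: (@chart_inv_continuous R d G 0 chart_img0). Qed.

Lemma cvg_mulg (T : Type) (F : set_system T) {FF : Filter F} (f g : T -> G) x y :
  f @ F --> x -> g @ F --> y -> (f t * g t)%g @[t --> F] --> (x * y)%g.
Proof.
move=> fx gy; have /= := @lie_continuous_mul R d G (x, y).
by move=> /(cvg_comp _ _ (cvg_pair fx gy)); apply.
Qed.

Definition conj_chart (a : G) (u : 'rV[R]_d) : 'rV[R]_d := phi (a * psi u * a^-1)%g.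

Lemma conj_chart0 a : conj_chart a 0 = 0.
Proof. by rewrite /conj_chart chart_inv0 mulg1 mulgV chart1. Qed.

Lemma conj_cvg1 (a : G) : (a * psi u * a^-1)%g @[u --> (0 : 'rV[R]_d)] --> (1%g : G).
Proof.
have -> : (1%g : G) = (a * 1 * a^-1)%g by rewrite mulg1 mulgV.
exact: (cvg_mulg (cvg_mulg (cvg_cst a) chart_inv_cvg0) (cvg_cst (a^-1)%g)).
Qed.

Lemma near_conj_dom a : \forall u \near (0 : 'rV[R]_d), dom (a * psi u * a^-1)%g.
Proof. exact: (conj_cvg1 a) near_chart_dom. Qed.

Lemma conj_chart_differentiable a : differentiable (conj_chart a) 0.
Proof.
have [h _] := @lie_smooth_mul R d G a (a^-1)%g 1%g 1%N.
have -> : conj_chart a = (fun p : 'rV[R]_d * 'rV[R]_d =>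
   phi (1^-1 * ((a * psi p.1) * (a^-1 * psi p.2)))%g) \o (fun u => (u, 0)).
  by apply/funext => u; rewrite /conj_chart /= chart_inv0 invg1 mul1g mulg1.
apply: differentiable_comp.
  exact: differentiable_pair.
apply: h; split; rewrite /= ?chart_inv0; [exact: chart_img0 | exact: chart_img0 |].
by rewrite invg1 mul1g !mulg1 mulgV; exact: chart_dom1.
Qed.

Lemma AdE a v : Ad a v = 'd (conj_chart a) 0 v.
Proof.
rewrite /Ad /tmap /dfun; congr ('d _ 0 v); apply/funext => u.
by rewrite /conj_chart mulg1 mulgV invg1 !mul1g.
Qed.

Lemma is_diff_conj_chart a : is_diff (0 : 'rV[R]_d) (conj_chart a) (Ad a).
Proof.
have -> : Ad a = 'd (conj_chart a) 0 :> (_ -> _) by apply/funext => v; rewrite AdE.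
exact/differentiableP/conj_chart_differentiable.
Qed.

Lemma Ad_linear (a : G) : linear (Ad a).
Proof. by move=> k u v; rewrite !AdE linearP. Qed.

(** Chain rule: conjugation by [a * b] is a composite of conjugations that fix
    the identity, where every map is read in the same chart. *)
Lemma AdM (a b : G) v : Ad (a * b)%g v = Ad a (Ad b v) :> 'rV[R]_d.
Proof.
have hb := is_diff_conj_chart b; have ha := is_diff_conj_chart a.
rewrite -(conj_chart0 b) in ha.
have hab := @is_diff_comp _ _ _ _ _ _ _ _ _ hb ha.
have h : is_diff (0 : 'rV[R]_d) (conj_chart (a * b)%g) (Ad a \o Ad b).
  apply: near_eq_is_diff hab.
  apply: filterS (near_conj_dom b) => u Du.
  by rewrite /conj_chart /= chartK // invgM !mulgA.
exact: (congr1 (@^~ v) (is_diff_unique (is_diff_conj_chart (a * b)%g) h)).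
Qed.

Lemma Ad1 v : Ad (1%g : G) v = v.
Proof.
have h : is_diff (0 : 'rV[R]_d) (conj_chart 1%g) id.
  apply: near_eq_is_diff (is_diff_id 0).
  apply: filterS near_chart_img => u /chart_invK[_ Eu].
  by rewrite /conj_chart invg1 mulg1 mul1g Eu.
exact: (congr1 (@^~ v) (is_diff_unique (is_diff_conj_chart 1%g) h)).
Qed.

(** Read in the charts centred at [x] and [a * x], a left translation is the
    identity; so left-invariant tensor fields are constant matrices. *)
Lemma tmap_left (a x : G) v : tmap (fun y : G => (a * y)%g) x v = v :> 'rV[R]_d.
Proof.
rewrite /tmap /dfun.
have h : is_diff (0 : 'rV[R]_d)
   (fun u => phi ((a * x)^-1 * (a * (x * psi u)))%g) id.
  apply: near_eq_is_diff (is_diff_id 0).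
  apply: filterS near_chart_img => u /chart_invK[_ Eu].
  by rewrite [(a * (x * _))%g]mulgA mulKg Eu.
by rewrite (@diff_val _ _ _ _ _ _ _ h).
Qed.

(** In the left trivialization a right translation acts as conjugation by the
    inverse, so right [T]-invariance of a constant tensor is invariance under
    [Ad] of [T]. *)
Lemma tmap_right (t x : G) v : tmap (fun y : G => (y * t)%g) x v = Ad (t^-1)%g v :> 'rV[R]_d.
Proof.
rewrite AdE /tmap /dfun; congr ('d _ 0 v); apply/funext => u.
by rewrite /conj_chart invgK invgM -!mulgA mulKg.
Qed.

Lemma dfun_cst (W : normedModType R) (w : W) (x : G) v : dfun (fun=> w) x v = 0.
Proof. by rewrite /dfun diff_cst. Qed.

(** Smoothness of order 2 of the multiplication: the differential in a fixed
    direction is again differentiable in the base point. *)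
Lemma differentiable_chart_mul :
  let m := fun p : 'rV[R]_d * 'rV[R]_d => phi (psi p.1 * psi p.2)%g in
  forall p, (phi @` dom) p.1 -> (phi @` dom) p.2 -> dom (psi p.1 * psi p.2)%g ->
  differentiable m p /\ forall w, differentiable (fun q => 'd m q w) p.
Proof.
move=> m p h1 h2 h3.
have /= [hm hdm] := @lie_smooth_mul R d G 1%g 1%g 1%g 2%N.
have E : (fun p : 'rV[R]_d * 'rV[R]_d =>
   phi (1^-1 * ((1 * psi p.1) * (1 * psi p.2)))%g) = m.
  by apply/funext => q; rewrite invg1 !mul1g.
have Op : [set p : 'rV[R]_d * 'rV[R]_d | [/\ (phi @` dom) p.1,
         (phi @` dom) p.2 & dom (1^-1 * ((1 * psi p.1) * (1 * psi p.2)))%g]] p.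
  by split => //; rewrite invg1 !mul1g.
rewrite E in hm hdm; split; first exact: hm.
by move=> w; have [h _] := hdm w; exact: h.
Qed.

Lemma near_chart_inv_dom : \forall s \near (0 : 'rV[R]_d), dom (psi s)^-1%g.
Proof.
have h : (psi s)^-1%g @[s --> (0 : 'rV[R]_d)] --> (1%g : G).
  have := @lie_continuous_inv R d G 1%g; rewrite /continuous_at invg1.
  by move/(cvg_comp _ _ chart_inv_cvg0).
exact: h near_chart_dom.
Qed.

(** Conjugation is [m (m (s, u), s^-1)] in the chart, with [m] the
    multiplication; only the first partial derivatives of [m] occur when this
    is differentiated in [u], at base points that depend on [s]. *)
Lemma Ad_chartE (s v : 'rV[R]_d) : (phi @` dom) s -> dom (psi s)^-1%g ->
  let m := fun p : 'rV[R]_d * 'rV[R]_d => phi (psi p.1 * psi p.2)%g in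
  Ad (psi s) v = 'd m (s, phi (psi s)^-1%g) ('d m (s, 0) (0, v), 0).
Proof.
move=> Us Ds m; have [Dp Es] := chart_invK Us.
have [dm1 _] : differentiable m (s, 0 : 'rV[R]_d) /\
    forall w, differentiable (fun q => 'd m q w) (s, 0 : 'rV[R]_d).
  by apply: differentiable_chart_mul => //=; [exact: chart_img0 | rewrite chart_inv0 mulg1].
have [dm2 _] : differentiable m (s, phi (psi s)^-1%g) /\
    forall w, differentiable (fun q => 'd m q w) (s, phi (psi s)^-1%g).
  apply: differentiable_chart_mul => //=; first by exists (psi s)^-1%g.
  by rewrite chartK // mulgV; exact: chart_dom1.
have i1 : is_diff (0 : 'rV[R]_d) (fun u : 'rV[R]_d => (s, u)) (fun u => (0, u)).
  exact: is_diff_pair.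
have i2 := @is_diff_comp _ _ _ _ _ _ _ _ _ i1 (differentiableP dm1).
have i3 : is_diff (0 : 'rV[R]_d) (fun u : 'rV[R]_d => (m (s, u), phi (psi s)^-1%g))
    (fun u => ('d m (s, 0) (0, u), 0)).
  apply: (@is_diff_pair _ _ _ _ _ _ (cst (phi (psi s)^-1%g)) 0 _ i2).
have ms : m (s, 0) = s by rewrite /m /= chart_inv0 mulg1.
have i4 : is_diff (0 : 'rV[R]_d) (fun u : 'rV[R]_d => m (m (s, u), phi (psi s)^-1%g))
    (fun u => 'd m (s, phi (psi s)^-1%g) ('d m (s, 0) (0, u), 0)).
  apply: (@is_diff_comp _ _ _ _ _ _ m _ _ i3).
  by rewrite ms; exact: differentiableP.
have i5 : is_diff (0 : 'rV[R]_d) (conj_chart (psi s))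
    (fun u => 'd m (s, phi (psi s)^-1%g) ('d m (s, 0) (0, u), 0)).
  apply: near_eq_is_diff i4.
  have h : (psi s * psi u)%g @[u --> (0 : 'rV[R]_d)] --> (psi s * 1)%g.
    exact: (cvg_mulg (cvg_cst _) chart_inv_cvg0).
  have nD : nbhs (psi s * 1)%g dom.
    by rewrite mulg1; exact: open_nbhs_nbhs (conj (@chart_dom_open R d G) Dp).
  have hD : \forall u \near (0 : 'rV[R]_d), dom (psi s * psi u)%g := h _ nD.
  apply: filterS hD => u Du.
  by rewrite /m /= !chartK.
exact: (congr1 (@^~ v) (is_diff_unique (is_diff_conj_chart _) i5)).
Qed.

Lemma linear_pair_row (n : nat) (V W : normedModType R)
    (L : {linear ('rV[R]_n * V)%type -> W}) (w : 'rV[R]_n) :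
  L (w, 0) = \sum_(j < n) w 0 j *: L (delta_mx 0 j, 0).
Proof.
pose f (u : 'rV[R]_n) := L (u, 0).
have lf : linear f.
  move=> k x y; rewrite /f -linearP; congr (L _).
  by apply/eqP; rewrite xpair_eqE /= scaler0 addr0 !eqxx.
pose lM := GRing.isLinear.Build _ _ _ _ _ lf.
pose fL : {linear _ -> _} := HB.pack f lM.
rewrite -[LHS]/(fL w) (row_sum_delta w) linear_sum.
by apply: eq_bigr => j _; rewrite linearZ -row_sum_delta.
Qed.

(** [Ad (psi s) v] is a partial derivative of the multiplication applied to
    another one, and both depend differentiably on [s].  Expanding the inner
    vector in coordinates turns the application into a sum of products. *)
Lemma Ad_chart_differentiable (v : 'rV[R]_d) :
  differentiable (fun s => Ad (psi s) v) 0.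
Proof.
pose m := fun p : 'rV[R]_d * 'rV[R]_d => phi (psi p.1 * psi p.2)%g.
pose i := fun s : 'rV[R]_d => phi (psi s)^-1%g.
have i0 : i 0 = 0 by rewrite /i chart_inv0 invg1 chart1.
have di : differentiable i 0.
  have [h _] := @lie_smooth_inv R d G 1%g 1%g 1%N.
  have -> : i = (fun u => phi (1^-1 * (1 * psi u)^-1)%g).
    by apply/funext => u; rewrite invg1 !mul1g.
  apply: h; split; first exact: chart_img0.
  by rewrite chart_inv0 invg1 !mul1g invg1; exact: chart_dom1.
have [_ dm] : differentiable m (0 : 'rV[R]_d, 0 : 'rV[R]_d) /\
    forall w, differentiable (fun q => 'd m q w) (0 : 'rV[R]_d, 0 : 'rV[R]_d).
  apply: differentiable_chart_mul => //=; try exact: chart_img0.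
  by rewrite chart_inv0 mulg1; exact: chart_dom1.
pose k j := fun s : 'rV[R]_d => ('d m (s, 0) (0, v)) 0 j.
pose f (j : 'I_d) := fun s : 'rV[R]_d => 'd m (s, i s) (delta_mx 0 j, 0).
have dk j : differentiable (k j) 0.
  apply: (@differentiable_comp _ _ _ _ (fun s : 'rV[R]_d => 'd m (s, 0) (0, v))
    (fun M : 'rV[R]_d => M 0 j)); last exact: differentiable_coord.
  apply: (@differentiable_comp _ _ _ _ (fun s : 'rV[R]_d => (s, 0 : 'rV[R]_d))
    (fun q => 'd m q (0, v))); last exact: dm.
  exact: differentiable_pair.
have df j : differentiable (f j) 0.
  apply: (@differentiable_comp _ _ _ _ (fun s : 'rV[R]_d => (s, i s))
    (fun q => 'd m q (delta_mx 0 j, 0))); last by rewrite i0; exact: dm.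
  exact: differentiable_pair.
have dS : differentiable (\sum_(j < d) (fun s => k j s *: f j s)) 0.
  apply: differentiable_sum => j.
  by have [] := is_diffZv (differentiableP (dk j)) (differentiableP (df j)).
suff : is_diff (0 : 'rV[R]_d) (fun s => Ad (psi s) v)
    ('d (\sum_(j < d) (fun s => k j s *: f j s)) 0) by case.
apply: near_eq_is_diff (differentiableP dS).
near=> s; rewrite fct_sumE.
have -> : Ad (psi s) v = 'd m (s, i s) ('d m (s, 0) (0, v), 0).
  apply: Ad_chartE; first by near: s; exact: near_chart_img.
  by near: s; exact: near_chart_inv_dom.
by rewrite linear_pair_row.
Unshelve. all: by end_near. Qed.

Lemma lie_bracketE (u v : 'rV[R]_d) :
  lie_bracket G u v = 'd (fun s => Ad (psi s) v) 0 u.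
Proof.
have E : (fun s => Ad (1 * psi s)%g v) = (fun s => Ad (psi s) v).
  by apply/funext => s; rewrite mul1g.
exact: (congr1 (fun f : 'rV[R]_d -> 'rV[R]_d => 'd f 0 u) E).
Qed.

Lemma is_diff_Ad_chart (v : 'rV[R]_d) :
  is_diff (0 : 'rV[R]_d) (fun s => Ad (psi s) v) (fun u => lie_bracket G u v).
Proof.
apply: DiffDef; first exact: Ad_chart_differentiable.
by apply/funext => u; rewrite lie_bracketE.
Qed.

End LieGroup.

(** * The Lie bracket and the action of a torus *)

Section LieGroup.
Variables (R : realType) (d : nat) (G : lieGroupType R d).
Local Notation phi := (@chart R d G).
Local Notation psi := (@chart_inv R d G).
Local Notation dom := (@chart_dom R d G).
#[local] Opaque Ad lie_bracket.

Lemma lie_bracket_linearl v : linear (fun u => lie_bracket G u v).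
Proof. by move=> k u w; rewrite !lie_bracketE linearP. Qed.

Lemma lie_bracket_linearr u : linear (lie_bracket G u).
Proof.
move=> k v w.
have hv := is_diff_Ad_chart G v; have hw := is_diff_Ad_chart G w.
have h := @is_diffD _ _ _ _ _ _ _ _ (@is_diffZ _ _ _ _ _ k _ hv) hw.
have E : (fun s => Ad (psi s) (k *: v + w)) =
    k *: (fun s => Ad (psi s) v) + (fun s => Ad (psi s) w).
  by apply/funext => s; rewrite Ad_linear.
rewrite -E in h.
exact: (congr1 (@^~ u) (is_diff_unique (is_diff_Ad_chart G _) h)).
Qed.

Lemma AdK (a : G) (w : 'rV[R]_d) : Ad a^-1%g (Ad a w) = w.
Proof. by rewrite -(AdM a^-1%g a w) mulVg Ad1. Qed.

(** Differentiate [Ad a \o Ad b \o Ad a^-1 = Ad (a b a^-1)] in [b]. *)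
Lemma Ad_bracket (a : G) v w :
  Ad a (lie_bracket G v w) = lie_bracket G (Ad a v) (Ad a w).
Proof.
have h1 := is_diff_Ad_chart G w.
have h2 := fun x => is_diff_linear_fun x (Ad_linear a).
have h3 := is_diff_conj_chart a.
have hL : is_diff (0 : 'rV[R]_d) (fun s => Ad a (Ad (psi s) w))
    (fun u => Ad a (lie_bracket G u w)).
  exact: (is_diff_compE h1 erefl (h2 _)).
have hR : is_diff (0 : 'rV[R]_d) (fun s => Ad (psi (conj_chart a s)) (Ad a w))
    (fun u => lie_bracket G (Ad a u) (Ad a w)).
  have h4 := is_diff_Ad_chart G (Ad a w).
  exact: (is_diff_compE h3 (conj_chart0 a) h4).
have hL' : is_diff (0 : 'rV[R]_d) (fun s => Ad (psi (conj_chart a s)) (Ad a w))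
    (fun u => Ad a (lie_bracket G u w)).
  apply: near_eq_is_diff hL; apply: filterS (near_conj_dom a) => s Ds.
  have E : psi (conj_chart a s) = (a * psi s * a^-1)%g := chartK _ Ds.
  by rewrite E (AdM (a * psi s)%g a^-1%g (Ad a w)) AdK (AdM a (psi s) w).
exact: (congr1 (@^~ v) (is_diff_unique hL' hR)).
Qed.

(** The matrix of [v |-> [u, v]] acting on row vectors from the right, so that
    composition reverses the order of factors; likewise for [Adm] below. *)
Definition adm (u : 'rV[R]_d) : 'M[R]_d := lin1_mx (lie_bracket G u).

Lemma mul_adm u v : v *m adm u = lie_bracket G u v.
Proof.
pose lM := GRing.isLinear.Build _ _ _ _ _ (lie_bracket_linearr u).
pose fL : {linear _ -> _} := HB.pack (lie_bracket G u) lM.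
exact: (mul_rV_lin1 fL).
Qed.

(** Differentiate [Ad a [v, w] = [Ad a v, Ad a w]] in [a]. *)
Lemma lie_bracket_leibniz u v w :
  lie_bracket G u (lie_bracket G v w) =
  lie_bracket G (lie_bracket G u v) w + lie_bracket G v (lie_bracket G u w).
Proof.
pose F z := fun s => Ad (psi s) z.
have bE x y : lie_bracket G x y = \sum_(j < d) x 0 j *: (y *m adm (delta_mx 0 j)).
  pose lM := GRing.isLinear.Build _ _ _ _ _ (lie_bracket_linearl y).
  pose fL : {linear _ -> _} := HB.pack (fun x => lie_bracket G x y) lM.
  rewrite -[LHS]/(fL x) {1}(row_sum_delta x) linear_sum.
  by apply: eq_bigr => j _; rewrite linearZ mul_adm /=.
have F0 z : F z 0 = z by rewrite /F chart_inv0 Ad1.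
have hj j : is_diff (0 : 'rV[R]_d)
    (fun s => F v s 0 j *: (F w s *m adm (delta_mx 0 j)))
    (fun x => (lie_bracket G x v) 0 j *: (w *m adm (delta_mx 0 j))
            + v 0 j *: (lie_bracket G x w *m adm (delta_mx 0 j))).
  have h1 := @is_diff_comp _ _ _ _ _ _ _ _ _ (is_diff_Ad_chart G v) (is_diff_coord _ j).
  have h2 := @is_diff_comp _ _ _ _ _ _ _ _ _ (is_diff_Ad_chart G w)
     (is_diff_mulmx (adm (delta_mx 0 j)) _).
  by have := is_diffZv h1 h2; rewrite /= -/(F v 0) -/(F w 0) !F0.
have hS := is_diff_Ad_chart G (lie_bracket G v w).
have hS' : is_diff (0 : 'rV[R]_d) (fun s => Ad (psi s) (lie_bracket G v w))
  (fun x => lie_bracket G (lie_bracket G x v) w + lie_bracket G v (lie_bracket G x w)).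
  have -> : (fun s => Ad (psi s) (lie_bracket G v w)) =
     \sum_(j < d) (fun s => F v s 0 j *: (F w s *m adm (delta_mx 0 j))).
    by apply/funext => s; rewrite Ad_bracket bE fct_sumE.
  have -> : (fun x => lie_bracket G (lie_bracket G x v) w + lie_bracket G v (lie_bracket G x w)) =
    \sum_(j < d) (fun x => (lie_bracket G x v) 0 j *: (w *m adm (delta_mx 0 j))
            + v 0 j *: (lie_bracket G x w *m adm (delta_mx 0 j))).
    by apply/funext => s; rewrite fct_sumE !bE big_split.
  exact: is_diff_sum.
exact: (congr1 (@^~ u) (is_diff_unique hS hS')).
Qed.

(** A curve through the base point turns a differential into a velocity; this is
    how the curves in a torus that define its tangent space are used. *)
Lemma is_diff_along_curve (W : normedModType R) (c : R -> 'rV[R]_d) X (f df : 'rV[R]_d -> W)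
  (g : R -> W) :
  c 0 = 0 -> is_derive (0 : R) (1 : R) c X -> is_diff (0 : 'rV[R]_d) f df ->
  (\forall s \near (0 : R), f (c s) = g s) -> is_diff (0 : R) g (fun s => df (s *: X)).
Proof.
move=> c0 hc hf hg.
have dc : is_diff (0 : R) c (fun s => s *: X).
  have dc : differentiable c 0 by apply/derivable1_diffP; case: hc.
  apply: DiffDef => //; apply/funext => s.
  case: hc => _ <-; rewrite deriveE // -linearZ /=; congr ('d c 0 _).
  by rewrite /GRing.scale /= mulr1.
apply: (near_eq_is_diff hg); apply: (@is_diff_comp _ _ _ _ _ _ f _ _ dc).
by rewrite c0.
Qed.

Lemma lie_subalg_curve (T : set G) X : lie_subalg T X ->
  exists (gamma : R -> G), [/\ (forall s, T (gamma s)), phi (gamma 0) = 0,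
    (\forall s \near (0 : R), dom (gamma s))
    & is_derive (0 : R) (1 : R) (fun s => phi (gamma s)) X].
Proof.
case=> gamma [g0 gT gc gd]; exists gamma; split => //; first by rewrite g0 chart1.
have n1 : nbhs (gamma 0) dom by rewrite g0; exact: near_chart_dom.
exact: gc _ n1.
Qed.

(** Conjugation by [t] fixes each curve in the abelian group [T], hence its
    velocity. *)
Lemma Ad_torus (T : set G) t X : torus T -> T t -> lie_subalg T X -> Ad t X = X.
Proof.
move=> [_ _ _ Tc] Tt /lie_subalg_curve[gamma [gT g0 gdom gd]].
have h1 := is_diff_along_curve g0 gd (is_diff_conj_chart t).
have h2 := is_diff_along_curve g0 gd (is_diff_id 0).
have {}h1 : is_diff (0 : R) (fun s => phi (gamma s)) (fun s => Ad t (s *: X)).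
  apply: h1; apply: filterS gdom => s Ds.
  by rewrite /conj_chart chartK // (Tc t) // mulgK.
have {}h2 : is_diff (0 : R) (fun s => phi (gamma s)) (fun s => s *: X).
  by apply: h2; apply: filterE.
by have := congr1 (@^~ 1) (is_diff_unique h1 h2); rewrite scale1r.
Qed.

(** [Ad] is constant on [Y] along the curve with velocity [X]. *)
Lemma lie_subalg_abelian (T : set G) X Y : torus T ->
  lie_subalg T X -> lie_subalg T Y -> lie_bracket G X Y = 0.
Proof.
move=> tT /lie_subalg_curve[gamma [gT g0 gdom gd]] TY.
have h1 := is_diff_along_curve g0 gd (is_diff_Ad_chart G Y).
have {}h1 : is_diff (0 : R) (cst Y) (fun s => lie_bracket G (s *: X) Y).
  apply: h1; apply: filterS gdom => s Ds.
  by rewrite chartK // (Ad_torus tT).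
by have := congr1 (@^~ 1) (is_diff_unique h1 (is_diff_cst Y 0)); rewrite scale1r.
Qed.

Definition Adm (a : G) : 'M[R]_d := lin1_mx (Ad a).

Lemma mul_Adm a v : v *m Adm a = Ad a v.
Proof.
pose lM := GRing.isLinear.Build _ _ _ _ _ (Ad_linear a).
pose fL : {linear _ -> _} := HB.pack (Ad a) lM.
exact: (mul_rV_lin1 fL).
Qed.

#[local] Opaque Adm.

Lemma chart_cvg0 : phi x @[x --> (1%g : G)] --> (0 : 'rV[R]_d).
Proof.
rewrite -(@chart1 R d G); exact: (@chart_continuous R d G 1%g (@chart_dom1 R d G)).
Qed.

Lemma AdmM (a b : G) : Adm (a * b)%g = Adm b *m Adm a.
Proof.
apply/row_matrixP => i; rewrite !rowE mulmxA.
apply: etrans (mul_Adm _ _) _; apply: etrans (AdM a b _) _; apply: esym.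
by apply: etrans (mul_Adm _ _) _; apply: congr1; exact: mul_Adm.
Qed.

(** Continuity at the identity comes from differentiability there, and the
    homomorphism property carries it to every point. *)
Lemma Adm_continuous i j : continuous (fun x : G => Adm x i j).
Proof.
have c1 k l : Adm x k l @[x --> (1%g : G)] --> Adm (1%g : G) k l.
  have E x : Adm x k l = Ad x (delta_mx 0 k) 0 l.
    by rewrite -mul_Adm -rowE [RHS]mxE.
  have /differentiable_continuous c := Ad_chart_differentiable G (delta_mx 0 k).
  have c2 : Ad (psi (phi x)) (delta_mx 0 k) 0 l @[x --> (1%g : G)] -->
      (Ad (psi 0) (delta_mx 0 k) : 'rV[R]_d) 0 l.
    apply: (cvg_comp _ (fun M : 'rV[R]_d => M 0 l)); last exact: coord_continuous.
    exact: (cvg_comp _ _ chart_cvg0 c).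
  have e : Adm (1%g : G) k l = (Ad (psi 0) (delta_mx 0 k) : 'rV[R]_d) 0 l.
    apply: etrans (E _) _.
    exact: (@f_equal G R (fun y : G => (Ad y (delta_mx 0 k) : 'rV[R]_d) 0 l) _ _
      (esym (chart_inv0 G))).
  apply: (@eq_ind_r R _ (fun z => Adm x k l @[x --> (1%g : G)] --> z) _ _ e).
  apply: cvg_trans c2; apply: near_eq_cvg.
  apply: filterS (near_chart_dom G) => x Dx.
  have e1 : (Ad (psi (phi x)) (delta_mx 0 k) : 'rV[R]_d) 0 l = Adm x k l.
    apply: etrans _ (esym (E x)).
    have e0 : psi (phi x) = x := chartK _ Dx.
    exact: (@f_equal G R (fun y : G => (Ad y (delta_mx 0 k) : 'rV[R]_d) 0 l) _ _ e0).
  exact: e1.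
move=> a.
have ca : (a^-1 * x)%g @[x --> a] --> (1%g : G).
  have -> : (1%g : G) = (a^-1 * a)%g by rewrite mulVg.
  exact: (cvg_mulg (cvg_cst _) cvg_id).
have E x : Adm x i j = \sum_k Adm (a^-1 * x)%g i k * Adm a k j.
  have e : (a * (a^-1 * x))%g = x by rewrite mulgA mulgV mul1g.
  by rewrite -[in LHS]e AdmM [LHS]mxE.
have E' : (fun x => Adm x i j) = (fun x => \sum_k Adm (a^-1 * x)%g i k * Adm a k j).
  by apply/funext => x; exact: E.
have H : (\sum_k Adm (a^-1 * x)%g i k * Adm a k j) @[x --> a] -->
    \sum_k Adm (1%g : G) i k * Adm a k j.
  apply: cvg_big => //; first exact: add_continuous.
  move=> k _; apply: cvgM; last exact: cvg_cst.
  exact: (cvg_comp _ _ ca (c1 i k)).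
have e1 : \sum_k Adm (1%g : G) i k * Adm a k j = Adm a i j.
  by rewrite -(mulVg a); apply: esym; exact: E.
apply: (@eq_ind _ _ (fun f : G -> R => f x @[x --> a] --> Adm a i j) _ _ (esym E')).
exact: (@eq_ind _ _ (fun z : R => _ @[x --> a] --> z) H _ e1).
Qed.

Lemma Adm_bounded (T : set G) : compact T ->
  exists C : R, forall x, T x -> forall i j, `|Adm x i j| <= C.
Proof.
move=> cT.
have h (p : 'I_d * 'I_d) : exists C : R, forall x, T x -> `|Adm x p.1 p.2| <= C.
  have [M [_ hM]] : bounded_set ((fun x : G => Adm x p.1 p.2) @` T).
    apply: compact_bounded; apply: continuous_compact => //.
    by apply: continuous_subspaceT; exact: Adm_continuous.
  exists (M + 1) => x Tx; apply: (hM (M + 1)); first by rewrite ltrDl.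
  by exists x.
have [f hf] := choice h.
exists (\sum_p `|f p|) => x Tx i j.
apply: (le_trans (hf (i, j) x Tx)); apply: (le_trans (ler_norm _)).
by rewrite (bigD1 (i, j)) //= lerDl; apply: sumr_ge0.
Qed.

End LieGroup.

(** * Fixed points of bounded groups of matrices *)

Section FixedPoint.
Variables (R : realType) (n : nat).

Definition sqn (v : 'rV[R]_n) : R := \sum_j v 0 j ^+ 2.

Lemma sqn_ge0 v : 0 <= sqn v.
Proof. by apply: sumr_ge0 => j _; exact: sqr_ge0. Qed.

Lemma sqn_coord (v : 'rV[R]_n) j : v 0 j ^+ 2 <= sqn v.
Proof.
by rewrite /sqn (bigD1 j) //= lerDl; apply: sumr_ge0 => k _; exact: sqr_ge0.
Qed.

Lemma sqn_eq0 v : sqn v <= 0 -> v = 0.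
Proof.
move=> v0; apply/rowP => j; rewrite mxE; apply/eqP.
by rewrite -sqrf_eq0 eq_le sqr_ge0 andbT (le_trans (sqn_coord v j)).
Qed.

Lemma sqn_half u v :
  sqn (2^-1 *: (u + v)) = 2^-1 * sqn u + 2^-1 * sqn v - 4^-1 * sqn (u - v).
Proof.
rewrite /sqn !mulr_sumr -big_split /= -sumrB; apply: eq_bigr => j _.
by rewrite !mxE; field.
Qed.

Lemma sqn_mulmx (A : 'M[R]_n) C (v : 'rV[R]_n) :
  (forall i j, `|A i j| <= C) -> sqn (v *m A) <= (n%:R * (n%:R * C) ^+ 2) * sqn v.
Proof.
move=> hA; set s := Num.sqrt (sqn v).
have hs i : `|v 0 i| <= s.
  by rewrite -sqrtr_sqr ler_wsqrtr // sqn_coord.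
have h j : (v *m A) 0 j ^+ 2 <= (n%:R * C) ^+ 2 * sqn v.
  rewrite -[sqn v]sqr_sqrtr ?sqn_ge0 // -/s -exprMn -real_normK ?num_real //.
  apply: lerXn2r; rewrite ?nnegrE //.
    have [i0|C0] := pselect (exists i : 'I_n, True).
      case: i0 => i _; rewrite !mulr_ge0 ?sqrtr_ge0 //.
      exact: le_trans (hA i i).
    by case: C0; exists j.
  rewrite mxE (le_trans (ler_norm_sum _ _ _)) //.
  have -> : n%:R * C * s = \sum_(i < n) C * s.
    by rewrite sumr_const card_ord -[in RHS]mulr_natl mulrA.
  apply: ler_sum => i _; rewrite normrM mulrC.
  by apply: ler_pM => //; exact: hs.
rewrite {1}/sqn; apply: (le_trans (ler_sum _ (fun j _ => h j))).
by rewrite sumr_const card_ord -[leLHS]mulr_natl mulrA.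
Qed.

Lemma sqn_mulmx_continuous (A : 'M[R]_n) : continuous (fun v : 'rV[R]_n => sqn (v *m A)).
Proof.
have c1 : continuous sqn.
  apply: continuous_big; first exact: add_continuous.
  move=> j _ v; apply: (@continuous_comp _ _ _ (fun M : 'rV[R]_n => M 0 j) (fun x => x ^+ 2)).
    exact: coord_continuous.
  exact: exprn_continuous.
move=> v; apply: (@cvg_comp _ _ _ (mulmxr A) sqn); last exact: c1.
exact: (@linear_rV_continuous _ _ _ (mulmxr A)).
Qed.

(** The function [sup_(A in S) |v A|^2] is [S]-invariant and, since [S] is
    bounded together with its inverses, uniformly convex: the parallelogram law
    bounds the distance of two near-minimisers.  Hence its minimising sequences
    in [K] are Cauchy, and the unique minimiser is fixed by [S]. *)
Lemma bounded_group_fixed_point (S : set 'M[R]_n) (K : set 'rV[R]_n) C v0 :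
  S 1%:M -> (forall A B, S A -> S B -> S (A *m B)) ->
  (forall A, S A -> exists2 B, S B & A *m B = 1%:M) ->
  (forall A, S A -> forall i j, `|A i j| <= C) ->
  closed K -> (forall u v, K u -> K v -> K (2^-1 *: (u + v))) ->
  (forall A u, S A -> K u -> K (u *m A)) -> K v0 ->
  exists2 v, K v & forall A, S A -> v *m A = v.
Proof.
move=> S1 SM SV SC Kcl Kmid KS K0.
pose c := n%:R * (n%:R * C) ^+ 2 + 1.
have c0 : 0 < c by rewrite ltr_wpDl // mulr_ge0 // sqr_ge0.
have hc A v : S A -> sqn (v *m A) <= c * sqn v.
  move=> SA; apply: (le_trans (sqn_mulmx v (SC A SA))).
  by rewrite ler_wpM2r ?sqn_ge0 // lerDl.
have hcV A v : S A -> sqn v <= c * sqn (v *m A).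
  move=> SA; have [B SB AB] := SV A SA.
  by have := hc B (v *m A) SB; rewrite -mulmxA AB mulmx1.
pose E := [set r | exists2 v, K v & forall A, S A -> sqn (v *m A) <= r].
have E0 : E !=set0 by exists (c * sqn v0); exists v0 => // A SA; exact: hc.
have Elb : has_lbound E.
  exists 0 => r [v _ h]; have := h _ S1; rewrite mulmx1.
  exact: le_trans (sqn_ge0 v).
pose m := inf E.
pose F e := [set v | K v /\ forall A, S A -> sqn (v *m A) <= m + e].
have Fne e : 0 < e -> exists v, F e v.
  move=> e0; have [r [v Kv hv] re] := inf_adherent e0 (conj E0 Elb).
  by exists v; split => // A SA; apply: (le_trans (hv A SA)); exact: ltW.
(* the parallelogram law, applied to the midpoint *)
have Fclose e u v : F e u -> F e v -> sqn (u - v) <= 4 * c * e.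
  move=> [Ku hu] [Kv hv].
  have : E (m + e - sqn (u - v) / (4 * c)).
    exists (2^-1 *: (u + v)); first exact: Kmid.
    move=> A SA; rewrite -scalemxAl mulmxDl sqn_half.
    have := hcV A (u - v) SA; rewrite mulmxBl.
    have := hu A SA; have := hv A SA.
    set x := sqn (u *m A); set y := sqn (v *m A); set z := sqn (u *m A - v *m A).
    set t := sqn (u - v) => h1 h2 h3.
    have h4 : t / (4 * c) <= 4^-1 * z.
      by rewrite ler_pdivrMr ?mulr_gt0 // mulrCA mulrA mulrA divff ?mul1r // mulrC.
    by lra.
  move=> /(ge_inf Elb); rewrite -/m => h.
  have h' : sqn (u - v) / (4 * c) <= e by lra.
  by move: h'; rewrite ler_pdivrMr ?mulr_gt0 // mulrC.
have [u hu] := choice (fun k : nat => Fne k.+1%:R^-1 (ltac:(by rewrite invr_gt0))).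
have Fmono e e' v : e <= e' -> F e v -> F e' v.
  by move=> ee [Kv hv]; split => // A /hv h; apply: (le_trans h); rewrite lerD2l.
have nearF e : 0 < e -> \forall k \near \oo, F e (u k).
  move=> e0; near=> k; apply: Fmono (hu k); apply: ltW.
  by near: k; exact: near_infty_natSinv_lt (PosNum e0).
have ucv : cvg (u @ \oo).
  apply/cauchy_cvgP/cauchy_exP => e e0.
  pose e1 := e ^+ 2 / (4 * c + 1).
  have c41 : 0 < 4 * c + 1 by rewrite ltr_wpDl // mulr_ge0 // ltW.
  have e10 : 0 < e1 by rewrite divr_gt0 // exprn_gt0.
  have [w Fw] := Fne e1 e10; exists w.
  apply: filterS (nearF _ e10) => k Fk; split => // i j.
  rewrite (ord1 i) -ball_normE /=.
  have h : (w 0 j - u k 0 j) ^+ 2 < e ^+ 2.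
    apply: (@le_lt_trans _ _ (4 * c * e1)).
      apply: le_trans (Fclose _ _ _ Fw Fk).
      by have := sqn_coord (w - u k) j; rewrite !mxE.
    rewrite /e1 mulrA ltr_pdivrMr // mulrC ltr_pM2l ?exprn_gt0 //.
    by rewrite ltrDl.
  by rewrite -(@ltr_pXn2r _ 2) ?nnegrE ?normr_ge0 ?(ltW e0) // real_normK ?num_real.
pose l := lim (u @ \oo).
have ul : u k @[k --> \oo] --> l by [].
have Kl : K l.
  apply: (closed_cvg _ Kcl) ul.
  by apply: nearW => k; case: (hu k).
have Fl e : 0 < e -> F e l.
  move=> e0; split => // A SA.
  have cl := cvg_comp _ _ ul (@sqn_mulmx_continuous A l).
  apply: (closed_cvg _ (@closed_le _ (m + e))) cl.
  by apply: filterS (nearF _ e0) => k [_ hk]; exact: hk.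
exists l => // A SA; apply/eqP; rewrite eq_sym -subr_eq0; apply/eqP/sqn_eq0.
apply/ler_addgt0Pr => e e0; rewrite add0r.
have e10 : 0 < e / (4 * c) by rewrite divr_gt0 // mulr_gt0.
have := Fclose _ l (l *m A) (Fl _ e10).
rewrite mulrCA divff ?mulr1; last by rewrite mulf_neq0 // gt_eqF.
apply; split; first exact: KS.
by move=> B SB; rewrite -mulmxA; apply: (Fl _ e10).2; exact: SM.
Unshelve. all: by end_near. Qed.
End FixedPoint.

(** * Bilinear forms and contractions *)

Section Bilinear.
Variables (R : realType) (d : nat).
Implicit Types (u v w : 'rV[R]_d) (B g h A : 'M[R]_d).

Lemma bilinDl B u u' v : bilin B (u + u') v = bilin B u v + bilin B u' v.
Proof. by rewrite /bilin !mulmxDl mxE. Qed.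

Lemma bilinDr B u v v' : bilin B u (v + v') = bilin B u v + bilin B u v'.
Proof. by rewrite /bilin linearD mulmxDr mxE. Qed.

Lemma bilinZl B k u v : bilin B (k *: u) v = k * bilin B u v.
Proof. by rewrite /bilin -!scalemxAl mxE. Qed.

Lemma bilinZr B k u v : bilin B u (k *: v) = k * bilin B u v.
Proof. by rewrite /bilin linearZ -scalemxAr mxE. Qed.

Lemma bilinNl B u v : bilin B (- u) v = - bilin B u v.
Proof. by rewrite -scaleN1r bilinZl mulN1r. Qed.

Lemma bilinNr B u v : bilin B u (- v) = - bilin B u v.
Proof. by rewrite -scaleN1r bilinZr mulN1r. Qed.

Lemma bilin_delta B i j : bilin B (delta_mx 0 i) (delta_mx 0 j) = B i j.
Proof. by rewrite /bilin -rowE trmx_delta -colE !mxE. Qed.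

Lemma bilin_inj B B' : (forall u v, bilin B u v = bilin B' u v) -> B = B'.
Proof. by move=> h; apply/matrixP => i j; rewrite -!bilin_delta h. Qed.

Lemma bilin_mulmxl B C u v : bilin B (u *m C) v = bilin (C *m B) u v.
Proof. by rewrite /bilin !mulmxA. Qed.

Lemma bilin_mulmxr B C u v : bilin B u (v *m C) = bilin (B *m C^T) u v.
Proof. by rewrite /bilin trmx_mul !mulmxA. Qed.

Definition biadditive (X : 'rV[R]_d -> 'rV[R]_d -> R) : Prop :=
  (forall k u u' v, X (k *: u + u') v = k * X u v + X u' v) /\
  (forall k u v v', X u (k *: v + v') = k * X u v + X u v').

Lemma biadditive_mx X : biadditive X ->
  X = bilin (\matrix_(i, j) X (delta_mx 0 i) (delta_mx 0 j)).
Proof.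
move=> [Xl Xr]; apply/funext => u; apply/funext => v.
have X0l w : X 0 w = 0 by have := Xl (-1) 0 0 w; rewrite scaler0 addr0 mulN1r addNr.
have X0r w : X w 0 = 0 by have := Xr (-1) w 0 0; rewrite scaler0 addr0 mulN1r addNr.
have El n (k : 'I_n -> R) (e : 'I_n -> 'rV[R]_d) w :
    X (\sum_i k i *: e i) w = \sum_i k i * X (e i) w.
  elim/big_rec2: _ => [|i y z _ <-]; [exact: X0l | exact: Xl].
have Er n (k : 'I_n -> R) (e : 'I_n -> 'rV[R]_d) w :
    X w (\sum_i k i *: e i) = \sum_i k i * X w (e i).
  elim/big_rec2: _ => [|i y z _ <-]; [exact: X0r | exact: Xr].
rewrite {1}(row_sum_delta u) El /bilin !mxE.
under [RHS]eq_bigr do rewrite !mxE big_distrl.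
rewrite exchange_big /=; apply: eq_bigr => i _.
rewrite {1}(row_sum_delta v) Er big_distrr; apply: eq_bigr => j _ /=.
by rewrite !mxE; ring.
Qed.

(** The contraction of a bilinear form with the bivector [h]; when [h] is the
    inverse of a metric, this is the metric trace. *)
Definition contr (h : 'M[R]_d) (X : 'rV[R]_d -> 'rV[R]_d -> R) : R :=
  \sum_i \sum_j h i j * X (delta_mx 0 i) (delta_mx 0 j).

Lemma contr_bilin h B : contr h (bilin B) = \tr (B *m h^T).
Proof.
rewrite /contr /mxtrace; apply: eq_bigr => i _; rewrite mxE.
by apply: eq_bigr => j _; rewrite bilin_delta mxE mulrC.
Qed.

Lemma contrD h X Y : contr h (fun u v => X u v + Y u v) = contr h X + contr h Y.
Proof.
rewrite /contr -big_split; apply: eq_bigr => i _ /=; rewrite -big_split.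
by apply: eq_bigr => j _; rewrite /= mulrDr.
Qed.

Lemma contrN h X : contr h (fun u v => - X u v) = - contr h X.
Proof.
rewrite /contr -sumrN; apply: eq_bigr => i _; rewrite -sumrN.
by apply: eq_bigr => j _; rewrite mulrN.
Qed.

Lemma contrB h X Y : contr h (fun u v => X u v - Y u v) = contr h X - contr h Y.
Proof. by rewrite contrD contrN. Qed.

Lemma contr3 h X Y Z :
  contr h (fun u v => X u v + Y u v + Z u v) = contr h X + contr h Y + contr h Z.
Proof. by rewrite !contrD. Qed.

Lemma eq_contr h X Y : (forall u v, X u v = Y u v) -> contr h X = contr h Y.
Proof.
by move=> e; apply: eq_bigr => i _; apply: eq_bigr => j _; rewrite e.
Qed.

Lemma contr_flip h X : h^T = h -> contr h (fun u v => X v u) = contr h X.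
Proof.
move=> hs; rewrite /contr exchange_big; apply: eq_bigr => i _ /=.
by apply: eq_bigr => j _; rewrite -{1}hs mxE.
Qed.

(** Used with [A] the matrix of an automorphism, and with [A = I] to see that
    contractions are invariant under the complex structure. *)
Lemma contr_mulmx h A X : biadditive X ->
  contr h (fun u v => X (u *m A) (v *m A)) = contr (A^T *m h *m A) X.
Proof.
move=> /biadditive_mx ->; rewrite contr_bilin.
set B := \matrix_(i, j) _.
rewrite (@eq_contr _ _ (bilin (A *m B *m A^T))); last first.
  by move=> u v; rewrite bilin_mulmxl bilin_mulmxr.
rewrite contr_bilin !trmx_mul trmxK -[_ *m h^T]mulmxA mxtrace_mulC !mulmxA.
by rewrite mxtrace_mulC !mulmxA.
Qed.

Lemma contrD_h h h' X : contr (h + h') X = contr h X + contr h' X.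
Proof.
rewrite /contr -big_split; apply: eq_bigr => i _ /=; rewrite -big_split.
by apply: eq_bigr => j _; rewrite /= mxE mulrDl.
Qed.

Lemma contrZ_h k h X : contr (k *: h) X = k * contr h X.
Proof.
rewrite /contr big_distrr; apply: eq_bigr => i _ /=; rewrite big_distrr.
by apply: eq_bigr => j _; rewrite /= mxE mulrA.
Qed.

End Bilinear.

(** * Bismut connection forms *)

Section BismutAlgebra.
Variables (R : realType) (d : nat).
Implicit Types (u v w z : 'rV[R]_d) (g h I : 'M[R]_d).
Implicit Types (F Gamma ad : {linear 'rV[R]_d -> 'M[R]_d}).

(** The connection form and the bracket, both with their last index lowered. *)
Definition triform g F u v w : R := bilin g (v *m F u) w.

Lemma triform12 g F w : biadditive (fun u v => triform g F u v w).
Proof.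
split=> k u u' v; rewrite /triform.
  by rewrite linearP mulmxDr -scalemxAr bilinDl bilinZl.
by rewrite mulmxDl -scalemxAl bilinDl bilinZl.
Qed.

Lemma triform13 g F v : biadditive (fun u w => triform g F u v w).
Proof.
split=> k u u' w; rewrite /triform.
  by rewrite linearP mulmxDr -scalemxAr bilinDl bilinZl.
by rewrite bilinDr bilinZr.
Qed.

Lemma triform23 g F u : biadditive (fun v w => triform g F u v w).
Proof.
split=> k v w w'; rewrite /triform.
  by rewrite mulmxDl -scalemxAl bilinDl bilinZl.
by rewrite bilinDr bilinZr.
Qed.

Lemma triformNr g F u v w : triform g F u v (- w) = - triform g F u v w.
Proof. exact: bilinNr. Qed.

Lemma triformNm g F u v w : triform g F u (- v) w = - triform g F u v w.
Proof. by rewrite /triform mulNmx bilinNl. Qed.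

Definition lie_antisymmetric ad := forall u v, v *m ad u = - (u *m ad v).

(** The inverse matrix [h] is part of the data because the CYT condition is linear
    in it. *)
Record hermitian_form g h I : Prop := HermitianForm {
  hf_sym : forall u v, bilin g u v = bilin g v u;
  hf_inv : g *m h = 1%:M;
  hf_J2 : I *m I = - 1%:M;
  hf_I : forall u v, bilin g (u *m I) (v *m I) = bilin g u v }.

(** The pointwise content of the Bismut conditions for a left-invariant
    Hermitian structure. *)
Record bismut_form ad g I Gamma : Prop := BismutForm {
  bf_metric : forall u v w, triform g Gamma u v w = - triform g Gamma u w v;
  bf_endo : forall u, I *m Gamma u = Gamma u *m I;
  bf_torsion : forall u v w,
    triform g Gamma u v w - triform g Gamma v u w - triform g ad u v w =
    - (triform g Gamma u w v - triform g Gamma w u v - triform g ad u w v) }.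

Section Fixed.
Variables (ad : {linear 'rV[R]_d -> 'M[R]_d}) (g h I : 'M[R]_d).
Hypotheses (hanti : lie_antisymmetric ad) (hH : hermitian_form g h I).

Lemma mulJJ u : u *m I *m I = - u.
Proof. by rewrite -mulmxA (hf_J2 hH) mulmxN mulmx1. Qed.

Lemma hform_gT : g^T = g.
Proof.
apply/matrixP => i j; rewrite mxE -bilin_delta -[RHS]bilin_delta.
exact: hf_sym hH _ _.
Qed.

Lemma hform_hg : h *m g = 1%:M.
Proof. exact: mulmx1C (hf_inv hH). Qed.

Lemma hform_hT : h^T = h.
Proof.
have e : h^T *m g = 1%:M by rewrite -{1}hform_gT -trmx_mul (hf_inv hH) trmx1.
by rewrite -[LHS]mulmx1 -(hf_inv hH) mulmxA e mul1mx.
Qed.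

Lemma hform_IgI : I *m g *m I^T = g.
Proof.
apply: bilin_inj => u v; rewrite -[RHS](hf_I hH).
by rewrite bilin_mulmxl bilin_mulmxr.
Qed.

Lemma hform_gIT : g *m I^T = - (I *m g).
Proof.
rewrite -{2}hform_IgI !mulmxA (hf_J2 hH) !mulNmx mul1mx opprK //.
Qed.

Lemma hform_hI : I^T *m h *m I = h.
Proof.
have e1 : I^T *m h = - (h *m I).
  rewrite -[I^T]mul1mx -hform_hg -!mulmxA [g *m (_ *m _)]mulmxA hform_gIT.
  by rewrite mulNmx mulmxN -mulmxA (hf_inv hH) mulmx1.
by rewrite e1 mulNmx -mulmxA (hf_J2 hH) mulmxN opprK mulmx1.
Qed.

Lemma hform_nondeg u v : (forall w, bilin g u w = bilin g v w) -> u = v.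
Proof.
move=> e; rewrite -[u]mulmx1 -[v]mulmx1 -(hf_inv hH) !mulmxA; congr (_ *m _).
apply/rowP => j; have := e (delta_mx 0 j).
by rewrite /bilin trmx_delta -!colE !mxE.
Qed.

Lemma contrJ X : biadditive X ->
  contr h (fun u v => X (u *m I) (v *m I)) = contr h X.
Proof. by move=> bX; rewrite contr_mulmx // hform_hI. Qed.

Lemma contr_anti X : (forall u v, X u v = - X v u) -> contr h X = 0.
Proof.
move=> aX; have := contr_flip X hform_hT.
rewrite (@eq_contr _ _ h (fun u v => X v u) (fun u v => - X u v)); last first.
  by move=> u v; rewrite aX.
by rewrite contrN => e; lra.
Qed.

(** The part of the trace that depends on the complex structure alone. *)
Definition koszul_form (J : 'M[R]_d) w : R := \tr (ad w *m J) + \tr (ad (w *m J)).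

(** In the trace of the Bismut connection form the metric enters only through the
    vector [sum_i [e_i, I e_i]] paired with [w], for an orthonormal basis [e_i].

    With [c] the torsion 3-form, the torsion equation for [(w, e, I e)] and for
    [(e, I e, w)] expresses the trace of [Gamma_w I] by brackets and by the
    contraction of [c (e, I e, w)].  The latter comes from contracting
    the identity [tors] below, the relation between the torsion and the exterior
    derivative of the fundamental form. *)
Lemma bismut_trace Gamma w : bismut_form ad g I Gamma ->
  \tr (Gamma w *m I) =
  koszul_form I w + contr h (fun u v => triform g ad u (v *m I) w).
Proof.
move=> hB.
pose A := triform g Gamma; pose B := triform g ad.
pose c u v z := A u v z - A v u z - B u v z.
have Bs u v z : B u v z = - B v u z.
  by rewrite /B /triform hanti bilinNl.
have c23 u v z : c u v z = - c u z v by exact: bf_torsion hB _ _ _.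
have c12 u v z : c u v z = - c v u z by rewrite /c (Bs u v z); ring.
have cyc u v z : c u v z = c v z u by rewrite c12 c23 opprK.
have AI u v z : A u (v *m I) (z *m I) = A u v z.
  by rewrite /A /triform -mulmxA (bf_endo hB) mulmxA (hf_I hH).
have AJ u v z : A u v (z *m I) = A u z (v *m I).
  rewrite -[LHS]AI mulJJ /A triformNr (bf_metric hB) -/(A _ _ _) opprK //.
have As u v z : A u v z = - A u z v by exact: bf_metric hB _ _ _.
(* the connection terms cancel in the cyclic sum because [AJ] makes them
   symmetric in pairs *)
have tors u v z : c u v (z *m I) + c v z (u *m I) + c z u (v *m I) =
    - (B u v (z *m I) + B v z (u *m I) + B z u (v *m I)).
  by rewrite /c (AJ u v z) (AJ v z u) (AJ z u v); ring.
have bAm z : biadditive (fun u v => A u z v) by exact: triform13.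
have bA z : biadditive (fun u v => A u v z) by exact: triform12.
have bBm z : biadditive (fun u v => B u z v) by exact: triform13.
have trz z : contr h (fun u v => B z u v) = \tr (ad z).
  rewrite (@eq_contr _ _ h _ (bilin (ad z *m g))); last first.
    by move=> u v; rewrite /B /triform bilin_mulmxl.
  by rewrite contr_bilin hform_hT -mulmxA (hf_inv hH) mulmx1.
pose s3 := contr h (fun u v => A u (v *m I) w).
pose b2 := contr h (fun u v => B u (v *m I) w).
pose c2 := contr h (fun u v => c u (v *m I) w).
have s3E : 2 * s3 = b2 + c2.
  have e1 : s3 = - contr h (fun u v => A (v *m I) u w).
    rewrite /s3 -(@contr_flip _ _ h (fun u v => A (v *m I) u w)) ?hform_hT //.
    have bX : biadditive (fun u v => A u (v *m I) w).
      have [h1 h2] := bA w; split=> k u u' v; first exact: h1.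
      by rewrite mulmxDl -scalemxAl h2.
    rewrite -[LHS](contrJ bX) -contrN; apply: eq_contr => u v.
    by rewrite mulJJ /A triformNm.
  have -> : 2 * s3 = s3 - contr h (fun u v => A (v *m I) u w).
    by rewrite {2}e1 -/s3; lra.
  rewrite /s3 -contrB /b2 /c2 -contrD; apply: eq_contr => u v.
  by rewrite /c; ring.
have c2E : c2 = - 2 * \tr (ad (w *m I)) - b2.
  pose z := - (w *m I).
  have zI : z *m I = w by rewrite /z mulNmx mulJJ opprK.
  have t u v := tors z u (v *m I).
  have q1 : contr h (fun u v => c z u v) = 0.
    by apply: contr_anti => u v; exact: c23.
  have q2 : contr h (fun u v => c (v *m I) z (u *m I)) = 0.
    have e := @contr_flip _ _ h (fun u v => c (u *m I) z (v *m I)) hform_hT.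
    rewrite e.
    have bc : biadditive (fun u v => c u z v).
      rewrite (_ : (fun u v => c u z v) =
        (fun u v => A u z v - triform g Gamma z u v - B u z v)) //.
      have [a1 a2] := bAm z; have [b1 b2'] := triform23 g Gamma z.
      have [d1 d2] := bBm z.
      by split=> k u u' v; rewrite ?a1 ?b1 ?d1 ?a2 ?b2' ?d2; ring.
    rewrite (contrJ bc); apply: contr_anti => u v.
    by rewrite (c12 u z v) (c23 z u v) (c12 z v u) opprK.
  have q3 : contr h (fun u v => c u (v *m I) (z *m I)) = c2 by rewrite zI.
  have r3 : contr h (fun u v => B u (v *m I) (z *m I)) = b2 by rewrite zI.
  have r1 : contr h (fun u v => B z u v) = - \tr (ad (w *m I)).
    by rewrite trz /z linearN linearN.
  have r2 : contr h (fun u v => B (v *m I) z (u *m I)) = \tr (ad (w *m I)).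
    have e := @contr_flip _ _ h (fun u v => B (u *m I) z (v *m I)) hform_hT.
    rewrite e (contrJ (bBm z)) -[RHS]opprK -r1 -contrN.
    by apply: eq_contr => u v; exact: Bs.
  have q0 : contr h (fun u v => c z u (v *m I *m I)) = 0.
    rewrite -oppr0 -q1 -contrN; apply: eq_contr => u v.
    by rewrite mulJJ /c /A /B !triformNr; ring.
  have r0 : contr h (fun u v => B z u (v *m I *m I)) = \tr (ad (w *m I)).
    rewrite -[RHS]opprK -r1 -contrN; apply: eq_contr => u v.
    by rewrite mulJJ /B triformNr.
  have S := @eq_contr _ _ h _ _ t; rewrite contrN in S.
  rewrite (contr3 h (fun u v => c z u (v *m I *m I))
    (fun u v => c u (v *m I) (z *m I)) (fun u v => c (v *m I) z (u *m I))) in S.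
  rewrite (contr3 h (fun u v => B z u (v *m I *m I))
    (fun u v => B u (v *m I) (z *m I)) (fun u v => B (v *m I) z (u *m I))) in S.
  by move: S; rewrite q0 q2 q3 r0 r2 r3; lra.
have s1E : contr h (fun u v => A w u (v *m I)) = - \tr (Gamma w *m I).
  rewrite (@eq_contr _ _ h _ (bilin (Gamma w *m g *m I^T))); last first.
    by move=> u v; rewrite /A /triform bilin_mulmxl bilin_mulmxr.
  rewrite contr_bilin hform_hT -[_ *m g *m _]mulmxA hform_gIT.
  by rewrite mulmxN mulNmx -!mulmxA (hf_inv hH) mulmx1 linearN.
have b1E : contr h (fun u v => B w u (v *m I)) = - \tr (ad w *m I).
  rewrite (@eq_contr _ _ h _ (bilin (ad w *m g *m I^T))); last first.
    by move=> u v; rewrite /B /triform bilin_mulmxl bilin_mulmxr.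
  rewrite contr_bilin hform_hT -[_ *m g *m _]mulmxA hform_gIT.
  by rewrite mulmxN mulNmx -!mulmxA (hf_inv hH) mulmx1 linearN.
have s1 : contr h (fun u v => A w u (v *m I)) =
    - s3 + contr h (fun u v => B w u (v *m I)) + c2.
  rewrite /s3 -contrN -contrD /c2 -contrD; apply: eq_contr => u v.
  by rewrite -(As u w (v *m I)) -(cyc w u (v *m I)) /c; ring.
by rewrite /koszul_form -/b2; lra.
Qed.

(** The difference of two solutions is totally skew, and invariant under [I] in
    any two slots.  Applying [I] to the three pairs of slots in turn gives its
    negative, so it vanishes. *)
Lemma bismut_form_unique Gamma Gamma' :
  bismut_form ad g I Gamma -> bismut_form ad g I Gamma' ->
  forall u, Gamma u = Gamma' u.
Proof.
move=> hB hB' u0.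
pose D u v w := triform g Gamma u v w - triform g Gamma' u v w.
have D23 u v w : D u v w = - D u w v.
  by rewrite /D (bf_metric hB u v) (bf_metric hB' u v); ring.
have DI u v w : D u (v *m I) (w *m I) = D u v w.
  rewrite /D /triform -!mulmxA (bf_endo hB) (bf_endo hB') !mulmxA.
  by rewrite !(hf_I hH).
have D12 u v w : D u v w = - D v u w.
  have t1 := bf_torsion hB; have t2 := bf_torsion hB'.
  have e a b c : D a b c - D b a c = - (D a c b - D c a b).
    by have := t1 a b c; have := t2 a b c; rewrite /D; lra.
  have := e u v w; have := e v w u; have := e w u v.
  have := D23 u v w; have := D23 v w u; have := D23 w u v.
  have := D23 u w v; have := D23 v u w; have := D23 w v u.
  by lra.
have DIl u v w : D (u *m I) v (w *m I) = D u v w.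
  by rewrite D12 DI -D12.
have DIm u v w : D (u *m I) (v *m I) w = D u v w.
  by rewrite D23 DIl -D23.
have D0 u v w : D u v w = 0.
  have e1 : D u v w = - D u v w.
    have Dm x y z : D x (- y) z = - D x y z by rewrite /D !triformNm; ring.
    by rewrite -{1}DI -{1}DIm mulJJ Dm DIl.
  by lra.
apply/row_matrixP => i; rewrite !rowE; apply: hform_nondeg => w.
by apply/eqP; rewrite -subr_eq0; apply/eqP; exact: D0.
Qed.

Section Existence.
Hypothesis integrable : forall u v,
  (v *m I) *m ad u - (v *m I *m I) *m ad (u *m I) =
  (v *m ad u - v *m I *m ad (u *m I)) *m I.

Let D u v := v *m ad u - v *m I *m ad (u *m I).
Let T u v w := 2^-1 * (bilin g (D u v) w - bilin g (D u w) v
  - bilin g (w *m ad v + w *m I *m ad (v *m I)) u).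
Let Gam u := \matrix_(i, j) T u (delta_mx 0 i) (delta_mx 0 j) *m h.

Let DlinL k u u' v : D (k *: u + u') v = k *: D u v + D u' v.
Proof.
rewrite /D mulmxDl -scalemxAl !linearP /=.
by rewrite scalerDr addrACA.
Qed.
Let DlinR k u v v' : D u (k *: v + v') = k *: D u v + D u v'.
Proof.
by rewrite /D !mulmxDl -!scalemxAl scalerBr opprD addrACA.
Qed.

Let Tbi u : biadditive (T u).
Proof.
split=> k v w w'; rewrite /T.
  rewrite DlinR.
  rewrite !mulmxDl -!scalemxAl !linearP /=.
  rewrite !(bilinDl, bilinZl, bilinDr, bilinZr); ring.
rewrite DlinR.
rewrite !mulmxDl -!scalemxAl.
rewrite !(bilinDl, bilinZl, bilinDr, bilinZr); ring.
Qed.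

Let Gam_linear : linear Gam.
Proof.
move=> k u u'; rewrite /Gam scalemxAl -mulmxDl; congr (_ *m _).
apply/matrixP => i j; rewrite !mxE /T !DlinL.
by rewrite !(bilinDl, bilinZl, bilinDr, bilinZr); ring.
Qed.

(** The Koszul formula with torsion [- sum_cyc g([I u, I v], w)] becomes
    [2 g(Gamma_u v, w) = g(D(u, v), w) - g(D(u, w), v) - g([v, w] + [I v, I w], u)]
    with [D(u, v) = [u, v] - [I u, I v]].  Integrability of [I] says that
    [D(u, I v) = I D(u, v)], which makes every term invariant under applying [I]
    to both [v] and [w]; this is compatibility with [I]. *)
Lemma bismut_form_exists : exists Gamma, bismut_form ad g I Gamma.
Proof.
pose lM := GRing.isLinear.Build _ _ _ _ _ Gam_linear.
pose Ga : {linear 'rV[R]_d -> 'M[R]_d} := HB.pack Gam lM.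
have TE u v w : triform g Ga u v w = T u v w.
  rewrite (biadditive_mx (Tbi u)) /triform /bilin /= /Gam.
  by rewrite !mulmxA -[_ *m h *m g]mulmxA hform_hg mulmx1.
have Bs u v w : bilin g (v *m ad u) w = - bilin g (u *m ad v) w.
  by rewrite hanti bilinNl.
exists Ga; split.
- move=> u v w; rewrite !TE /T !bilinDl (Bs v w) (Bs (v *m I) (w *m I)); ring.
- move=> u; apply/row_matrixP => i.
  rewrite !rowE (mulmxA _ I (Ga u)) (mulmxA _ (Ga u) I).
  apply: hform_nondeg => w.
  rewrite -[w]opprK -mulJJ; set v := delta_mx 0 i; move: (- w *m I) => y.
  have -> : bilin g (v *m I *m Ga u) (y *m I) = T u (v *m I) (y *m I) := TE u _ _.
  have -> : bilin g (v *m Ga u *m I) (y *m I) = T u v y.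
    by rewrite (hf_I hH); exact: TE.
  have DI x : D u (x *m I) = D u x *m I by exact: integrable.
  rewrite /T !DI !(hf_I hH) !mulJJ linearN mulmxN mulNmx opprK.
  by rewrite [_ + _ *m ad v]addrC.
- move=> u v w; rewrite !TE /T /triform /D !bilinDl !bilinNl.
  rewrite (Bs v u) (Bs w u) (Bs w v) (Bs (v *m I) (u *m I)).
  rewrite (Bs (w *m I) (u *m I)) (Bs (w *m I) (v *m I)).
  by field.
Qed.
End Existence.
End Fixed.
End BismutAlgebra.

(** * The Killing form and the linear form of the CYT condition *)

Section KillingAlgebra.
Variables (R : realType) (d : nat) (ad : {linear 'rV[R]_d -> 'M[R]_d}).
Implicit Types (u v w : 'rV[R]_d).
Hypothesis leibniz : forall u v, ad (v *m ad u) = ad v *m ad u - ad u *m ad v.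
Hypothesis killing_nondeg :
  forall u, (forall v, \tr (ad u *m ad v) = 0) -> u = 0.

Lemma ad_faithful u : ad u = 0 -> u = 0.
Proof. by move=> u0; apply: killing_nondeg => v; rewrite u0 mul0mx linear0. Qed.

(** By the Leibniz identity [[u, u]] acts trivially, so it is in the radical of
    the Killing form; polarise [[u, u] = 0]. *)
Lemma leibniz_antisymmetric : lie_antisymmetric ad.
Proof.
have sq u : u *m ad u = 0 by apply: ad_faithful; rewrite leibniz subrr.
move=> u v; have := sq (u + v); rewrite linearD mulmxDl !mulmxDr !sq.
by rewrite add0r addr0 addrC => /eqP; rewrite addr_eq0 => /eqP.
Qed.

Lemma killing_invariant u v w :
  \tr (ad u *m ad (w *m ad v)) = \tr (ad (v *m ad u) *m ad w).
Proof.
rewrite (leibniz v w) (leibniz u v) mulmxBr mulmxBl.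
have trB (X Y : 'M[R]_d) : \tr (X - Y) = \tr X - \tr Y by exact: linearB.
rewrite !trB; congr (_ - _).
  by rewrite mulmxA mxtrace_mulC mulmxA.
by rewrite mulmxA.
Qed.

(** A functional that vanishes on brackets is represented through the Killing form
    by a vector [x] with [[x, v]] in the radical for all [v]; then [ad x = 0],
    so [x = 0]. *)
Lemma killing_perfect (f : 'rV[R]_d -> R) :
  (forall k u v, f (k *: u + v) = k * f u + f v) ->
  (forall u v, f (v *m ad u) = 0) -> forall w, f w = 0.
Proof.
move=> lf f0 w.
pose k u v := \tr (ad u *m ad v).
have bk : biadditive k.
  split=> c u u' v; rewrite /k.
    by rewrite linearP mulmxDl -scalemxAl linearD linearZ.
  by rewrite linearP mulmxDr -scalemxAr linearD linearZ.
set K := \matrix_(i, j) k (delta_mx 0 i) (delta_mx 0 j).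
have kE u v : k u v = bilin K u v by rewrite (biadditive_mx bk).
have Ku : K \in unitmx.
  rewrite -row_free_unit -kermx_eq0; apply/eqP/row_matrixP => i; rewrite row0.
  apply: killing_nondeg => v; rewrite -/(k _ v) kE /bilin.
  by rewrite -row_mul mulmx_ker row0 mul0mx mxE.
pose fr : 'rV[R]_d := \row_j f (delta_mx 0 j).
have f00 : f 0 = 0 by have := lf (-1) 0 0; rewrite scaler0 addr0 mulN1r addNr.
have fE v : f v = (fr *m v^T) 0 0.
  have El n (c : 'I_n -> R) (e : 'I_n -> 'rV[R]_d) :
      f (\sum_i c i *: e i) = \sum_i c i * f (e i).
    by elim/big_rec2: _ => [|i y z _ <-]; [exact: f00 | exact: lf].
  rewrite {1}(row_sum_delta v) El mxE; apply: eq_bigr => j _.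
  by rewrite !mxE mulrC.
pose x := fr *m invmx K.
have kx v : k x v = f v by rewrite kE fE /bilin /x mulmxKV.
have adx : ad x = 0.
  apply/row_matrixP => i; rewrite rowE row0; apply: killing_nondeg => v.
  by rewrite -killing_invariant -/(k _ _) kx f0.
by rewrite -kx (ad_faithful adx) /k linear0 mul0mx linear0.
Qed.

End KillingAlgebra.

Section Equivariance.
Variables (R : realType) (d : nat) (ad : {linear 'rV[R]_d -> 'M[R]_d}).
Implicit Types (u v w : 'rV[R]_d) (g h : 'M[R]_d).

Definition contrv h (Y : 'rV[R]_d -> 'rV[R]_d -> 'rV[R]_d) : 'rV[R]_d :=
  \sum_i \sum_j h i j *: Y (delta_mx 0 i) (delta_mx 0 j).

Lemma contrv_coord h Y k : contrv h Y 0 k = contr h (fun u v => Y u v 0 k).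
Proof.
rewrite /contrv /contr summxE; apply: eq_bigr => i _; rewrite summxE.
by apply: eq_bigr => j _; rewrite mxE.
Qed.

Lemma contr_bilinl h g Y w :
  contr h (fun u v => bilin g (Y u v) w) = bilin g (contrv h Y) w.
Proof.
rewrite /bilin /contrv !mulmx_suml summxE; apply: eq_bigr => i _.
rewrite !mulmx_suml summxE; apply: eq_bigr => j _.
by rewrite -!scalemxAl [RHS]mxE.
Qed.

Lemma contrv_mulr h Y A : contrv h (fun u v => Y u v *m A) = contrv h Y *m A.
Proof.
rewrite /contrv mulmx_suml; apply: eq_bigr => i _; rewrite mulmx_suml.
by apply: eq_bigr => j _; rewrite scalemxAl.
Qed.

Lemma contrv_mulmx h A (Y : 'rV[R]_d -> 'rV[R]_d -> 'rV[R]_d) : (forall k, biadditive (fun u v => Y u v 0 k)) ->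
  contrv (A^T *m h *m A) Y = contrv h (fun u v => Y (u *m A) (v *m A)).
Proof.
by move=> bY; apply/rowP => k; rewrite !contrv_coord -contr_mulmx.
Qed.

Variable I : 'M[R]_d.

Lemma biadditive_ad k : biadditive (fun u v => (v *m I *m ad u) 0 k).
Proof.
split=> c u u' v.
  by rewrite linearP mulmxDr -scalemxAr !mxE.
by rewrite !mulmxDl -!scalemxAl !mxE.
Qed.

(** The condition [tr (Gamma_w I) = 0] for all [w], multiplied by the inverse
    metric [h].  The metric enters [bismut_trace] through [h] and through the
    lowering of an index; after raising that index the condition is linear in [h],
    whereas it is not linear in the metric. *)
Definition cyt_defect h : 'rV[R]_d :=
  contrv h (fun u v => v *m I *m ad u) +
  (\row_k koszul_form ad I (delta_mx 0 k)) *m h.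

Lemma cyt_defectD h h' : cyt_defect (h + h') = cyt_defect h + cyt_defect h'.
Proof.
rewrite /cyt_defect mulmxDr addrACA; congr (_ + _).
by apply/rowP => k; rewrite mxE !contrv_coord contrD_h.
Qed.

Lemma cyt_defectZ c h : cyt_defect (c *: h) = c *: cyt_defect h.
Proof.
rewrite /cyt_defect -scalemxAr scalerDr; congr (_ + _).
by apply/rowP => k; rewrite mxE !contrv_coord contrZ_h.
Qed.

Lemma koszul_formE w : koszul_form ad I w =
  ((\row_k koszul_form ad I (delta_mx 0 k)) *m w^T) 0 0.
Proof.
rewrite {1}(row_sum_delta w) mxE /koszul_form mulmx_suml !linear_sum /=.
rewrite mulmx_suml !linear_sum /= -big_split; apply: eq_bigr => j _ /=.
by rewrite !mxE -!scalemxAl !linearZ /= -scalemxAl linearZ /=; ring.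
Qed.

Lemma cyt_defect_trace g h Gamma : lie_antisymmetric ad ->
  hermitian_form g h I -> bismut_form ad g I Gamma ->
  (forall w, \tr (Gamma w *m I) = 0) <-> cyt_defect h = 0.
Proof.
move=> anti hH hB.
set kos := \row_k koszul_form ad I (delta_mx 0 k).
have tE w : \tr (Gamma w *m I) = bilin g (cyt_defect h) w.
  rewrite (bismut_trace anti hH w hB) /triform contr_bilinl koszul_formE -/kos.
  rewrite /cyt_defect bilinDl addrC; congr (_ + _).
  by rewrite /bilin -/kos -[kos *m h *m g]mulmxA (hform_hg hH) mulmx1.
split=> [h0|d0 w]; last by rewrite tE d0 /bilin !mul0mx mxE.
apply: (hform_nondeg hH) => w.
by rewrite -tE h0 /bilin !mul0mx mxE.
Qed.

(** Every ingredient of the defect is natural under automorphisms of the bracket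
    that commute with the complex structure. *)
Lemma cyt_defect_aut A B h : A *m B = 1%:M -> A *m I = I *m A ->
  (forall u, A *m ad (u *m A) = ad u *m A) ->
  cyt_defect (A^T *m h *m A) = cyt_defect h *m A.
Proof.
move=> AB AI Aad.
have adA u : ad (u *m A) = B *m ad u *m A.
  by rewrite -mulmxA -Aad mulmxA (mulmx1C AB) mul1mx.
have trA (M : 'M[R]_d) : \tr (B *m M *m A) = \tr M.
  by rewrite mxtrace_mulC mulmxA AB mul1mx.
have kosA w : koszul_form ad I (w *m A) = koszul_form ad I w.
  rewrite /koszul_form -(mulmxA w) AI mulmxA !adA trA.
  by rewrite -mulmxA AI mulmxA -(mulmxA B) trA.
set kos := \row_k koszul_form ad I (delta_mx 0 k).
have kA : kos *m A^T = kos.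
  apply/rowP => k; rewrite [RHS]mxE -kosA koszul_formE -/kos trmx_mul trmx_delta.
  by rewrite mulmxA -colE [RHS]mxE.
rewrite /cyt_defect -/kos mulmxDl; congr (_ + _); last first.
  by rewrite !mulmxA kA.
rewrite contrv_mulmx; last exact: biadditive_ad.
rewrite -contrv_mulr; congr (contrv h _).
apply/funext => u; apply/funext => v.
by rewrite -(mulmxA v) AI -!mulmxA Aad.
Qed.

End Equivariance.

(** * The complexified bracket *)

Section ComplexVectors.
Variables (R : realType) (d : nat) (G : lieGroupType R d).
#[local] Opaque Ad lie_bracket.
Implicit Types (u v w X Y : 'rV[R]_d) (Z W : 'rV[R[i]]_d) (M : 'M[R]_d).
Local Notation br := (lie_bracket G).
Local Notation brC := (@lie_bracketC R d G).
Local Notation cplx := (map_mx (real_complex R)).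

Lemma brDl u v w : br (u + v) w = br u w + br v w.
Proof. by have := lie_bracket_linearl G w 1 u v; rewrite !scale1r. Qed.
Lemma brDr u v w : br w (u + v) = br w u + br w v.
Proof. by have := lie_bracket_linearr G w 1 u v; rewrite !scale1r. Qed.
Lemma br0l w : br 0 w = 0.
Proof. by apply: (addrI (br 0 w)); rewrite -brDl !addr0. Qed.
Lemma br0r w : br w 0 = 0.
Proof. by apply: (addrI (br w 0)); rewrite -brDr !addr0. Qed.
Lemma brZl k u w : br (k *: u) w = k *: br u w.
Proof. by have := lie_bracket_linearl G w k u 0; rewrite br0l !addr0. Qed.
Lemma brZr k u w : br w (k *: u) = k *: br w u.
Proof. by have := lie_bracket_linearr G w k u 0; rewrite br0r !addr0. Qed.
Lemma brNl u w : br (- u) w = - br u w.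
Proof. by rewrite -scaleN1r brZl scaleN1r. Qed.
Lemma brNr u w : br w (- u) = - br w u.
Proof. by rewrite -scaleN1r brZr scaleN1r. Qed.

Lemma re_cvec X Y : re_vec (cvec X Y) = X.
Proof. by apply/rowP => j; rewrite !mxE. Qed.
Lemma im_cvec X Y : im_vec (cvec X Y) = Y.
Proof. by apply/rowP => j; rewrite !mxE. Qed.

Lemma cvec_ext Z W : re_vec Z = re_vec W -> im_vec Z = im_vec W -> Z = W.
Proof.
move=> /rowP er /rowP ei; apply/rowP => j.
by move: (er j) (ei j); rewrite !mxE; case: (Z 0 j) (W 0 j) => [a b] [a' b'] /= -> ->.
Qed.

Lemma cvecK Z : cvec (re_vec Z) (im_vec Z) = Z.
Proof. by apply: cvec_ext; rewrite ?re_cvec ?im_cvec. Qed.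

Lemma cvecP Z : exists X Y, Z = cvec X Y.
Proof. by exists (re_vec Z), (im_vec Z); rewrite cvecK. Qed.

Lemma cvecD X Y X' Y' : cvec X Y + cvec X' Y' = cvec (X + X') (Y + Y').
Proof. by apply/rowP => j; rewrite !mxE. Qed.
Lemma cvecZ (c : R[i]) X Y : c *: cvec X Y =
  cvec (complex.Re c *: X - complex.Im c *: Y) (complex.Re c *: Y + complex.Im c *: X).
Proof. by apply/rowP => j; rewrite !mxE; case: c. Qed.
Lemma cvecN X Y : - cvec X Y = cvec (- X) (- Y).
Proof. by apply/rowP => j; rewrite !mxE. Qed.

Lemma re_vecD Z W : re_vec (Z + W) = re_vec Z + re_vec W.
Proof. by apply/rowP => j; rewrite !mxE; case: (Z 0 j) (W 0 j) => [a b] [a' b']. Qed.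
Lemma re_vecB Z W : re_vec (Z - W) = re_vec Z - re_vec W.
Proof. by apply/rowP => j; rewrite !mxE; case: (Z 0 j) (W 0 j) => [a b] [a' b']. Qed.

Lemma re_vec_mulmx Z M : re_vec (Z *m cplx M) = re_vec Z *m M.
Proof.
apply/rowP => j; rewrite !mxE (big_morph (@complex.Re R) (id1 := 0) (op1 := +%R)) //.
  by apply: eq_bigr => k _; rewrite !mxE; case: (Z 0 k) => a b /=; rewrite mulr0 subr0.
by case=> [a b] [a' b'].
Qed.
Lemma im_vec_mulmx Z M : im_vec (Z *m cplx M) = im_vec Z *m M.
Proof.
apply/rowP => j; rewrite !mxE (big_morph (@complex.Im R) (id1 := 0) (op1 := +%R)) //.
  by apply: eq_bigr => k _; rewrite !mxE; case: (Z 0 k) => a b /=; rewrite mulr0 add0r.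
by case=> [a b] [a' b'].
Qed.

Lemma cvec_mulmx X Y M : cvec X Y *m cplx M = cvec (X *m M) (Y *m M).
Proof.
by apply: cvec_ext; rewrite ?re_vec_mulmx ?im_vec_mulmx !(re_cvec, im_cvec).
Qed.

Lemma brC_cvec X Y X' Y' : brC (cvec X Y) (cvec X' Y') =
  cvec (br X X' - br Y Y') (br X Y' + br Y X').
Proof. by rewrite /lie_bracketC !re_cvec !im_cvec. Qed.

Lemma brBZl k l u v w : br (k *: u - l *: v) w = k *: br u w - l *: br v w.
Proof. by rewrite brDl brNl (brZl k u) (brZl l v). Qed.
Lemma brDZl k l u v w : br (k *: u + l *: v) w = k *: br u w + l *: br v w.
Proof. by rewrite brDl (brZl k u) (brZl l v). Qed.
Lemma brBZr k l u v w : br w (k *: u - l *: v) = k *: br w u - l *: br w v.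
Proof. by rewrite brDr brNr (brZr k u) (brZr l v). Qed.
Lemma brDZr k l u v w : br w (k *: u + l *: v) = k *: br w u + l *: br w v.
Proof. by rewrite brDr (brZr k u) (brZr l v). Qed.

#[local] Opaque cvec lie_bracketC.

Lemma brCDl Z Z' W : brC (Z + Z') W = brC Z W + brC Z' W.
Proof.
have [x [y ->]] := cvecP Z; have [x' [y' ->]] := cvecP Z'.
have [a [b ->]] := cvecP W.
rewrite cvecD !brC_cvec cvecD !brDl opprD.
by congr cvec; rewrite addrACA.
Qed.

Lemma brCZl c Z W : brC (c *: Z) W = c *: brC Z W.
Proof.
have [x [y ->]] := cvecP Z; have [a [b ->]] := cvecP W.
rewrite cvecZ !brC_cvec cvecZ !brBZl !brDZl.
move: (br x a) (br x b) (br y a) (br y b) => p q r s.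
by congr cvec; apply/rowP => j; rewrite !mxE; ring.
Qed.

Lemma brCZr c Z W : brC Z (c *: W) = c *: brC Z W.
Proof.
have [x [y ->]] := cvecP W; have [a [b ->]] := cvecP Z.
rewrite cvecZ !brC_cvec cvecZ !brBZr !brDZr.
move: (br a x) (br a y) (br b x) (br b y) => p q r s.
by congr cvec; apply/rowP => j; rewrite !mxE; ring.
Qed.

Lemma brC_cvec0 X X' Y' : brC (cvec X 0) (cvec X' Y') = cvec (br X X') (br X Y').
Proof.
rewrite brC_cvec; congr cvec.
  exact: etrans (congr1 (fun z => br X X' - z) (br0l Y')) (subr0 _).
exact: etrans (congr1 (fun z => br X Y' + z) (br0l X')) (addr0 _).
Qed.

Lemma brC_leibniz X Z W : brC (cvec X 0) (brC Z W) =
  brC (brC (cvec X 0) Z) W + brC Z (brC (cvec X 0) W).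
Proof.
have [x [y ->]] := cvecP Z; have [a [b ->]] := cvecP W.
rewrite brC_cvec !brC_cvec0 !brC_cvec cvecD !brDr brNr.
have L := lie_bracket_leibniz G X; congr cvec.
  by rewrite addrACA -opprD; congr (_ - _); exact: L.
by rewrite addrACA; congr (_ + _); exact: L.
Qed.

Lemma brC_anti Z W : (forall u v, br u v = - br v u) -> brC Z W = - brC W Z.
Proof.
move=> anti; have [x [y ->]] := cvecP Z; have [a [b ->]] := cvecP W.
rewrite !brC_cvec cvecN; congr cvec.
  by rewrite opprD; congr (_ - _); exact: anti.
by rewrite opprD addrC; congr (_ + _); exact: anti.
Qed.

Lemma brC_Ad (t : G) X Z : Ad t X = X ->
  brC (cvec X 0) (Z *m cplx (Adm t)) = brC (cvec X 0) Z *m cplx (Adm t).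
Proof.
move=> AX; have e v : br X (v *m Adm t) = br X v *m Adm t.
  have h := Ad_bracket t X v; rewrite AX in h.
  apply: etrans (congr1 (br X) (mul_Adm t v)) _.
  by apply: etrans (esym h) _; exact: esym (mul_Adm t (br X v)).
have [x [y ->]] := cvecP Z.
by rewrite cvec_mulmx !brC_cvec0 cvec_mulmx; congr cvec; exact: e.
Qed.

Lemma cplx_inj M M' : (forall Z, Z *m cplx M = Z *m cplx M') -> M = M'.
Proof.
move=> e; apply/row_matrixP => i; rewrite !rowE.
by have := congr1 (@re_vec R d) (e (cvec (delta_mx 0 i) 0)); rewrite !re_vec_mulmx !re_cvec.
Qed.

End ComplexVectors.

(** * Samelson complex structures *)

Section Samelson.
Variables (R : realType) (d : nat) (G : lieGroupType R d).
#[local] Opaque Ad lie_bracket Adm cvec lie_bracketC.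
Implicit Types (u v w X Y : 'rV[R]_d) (Z W : 'rV[R[i]]_d) (M : 'M[R]_d).
Local Notation br := (lie_bracket G).
Local Notation brC := (@lie_bracketC R d G).
Local Notation cplx := (map_mx (real_complex R)).
Variables (T : set G) (P : set (weight T)) (J : 'M[R]_d).
Hypotheses (Ttorus : torus T) (rsd : root_space_decomposition T)
  (Ppos : positive_system P).
Hypothesis (Jt : forall X, lie_subalg T X ->
  lie_subalg T (X *m J) /\ X *m J *m J = - X).
Hypothesis (Jp : forall a Z, P a -> root_space a Z ->
  Z *m cplx J = (0 +i* 1)%C *: Z).
Hypothesis (Jn : forall a Z, P a -> root_space (\- a) Z ->
  Z *m cplx J = - ((0 +i* 1)%C *: Z)).

Let ii : R[i] := (0 +i* 1)%C.
Let ii2 : ii * ii = -1.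
Proof. by apply/eqP; rewrite eq_complex /=; apply/andP; split; apply/eqP; ring. Qed.

Lemma weight_oppK (a : weight T) : \- (\- a) = a.
Proof. by apply/funext => H; rewrite /= opprK. Qed.

Lemma root_ind (Q : 'rV[R[i]]_d -> Prop) :
  (forall Z W, Q Z -> Q W -> Q (Z + W)) ->
  (forall Z, cartan T Z -> Q Z) ->
  (forall (a : weight T) Z, is_root a -> root_space a Z -> Q Z) -> forall Z, Q Z.
Proof.
move=> QD Qc Qr Z; have [H [n [a [F [cH hF ->]]]]] := rsd Z.
have Q0 : Q H by exact: Qc.
elim: n a F hF => [|n IH] a F hF; first by rewrite big_ord0 addr0.
rewrite big_ord_recr /= addrA; apply: QD.
  by apply: (IH (fun j => a (widen_ord (leqnSn n) j))) => j; exact: hF.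
by have [ra rF] := hF ord_max; exact: (Qr (a ord_max)).
Qed.

Lemma J_root (a : weight T) Z : is_root a -> root_space a Z ->
  (P a /\ Z *m cplx J = ii *: Z) \/ (P (\- a) /\ Z *m cplx J = - ii *: Z).
Proof.
case: Ppos => _ Ptot _ _ ra rZ; have [Pa|Pa] := Ptot a ra.
  by left; split => //; exact: Jp Pa rZ.
right; split => //; rewrite scaleNr; apply: Jn Pa _.
by rewrite weight_oppK.
Qed.

Lemma cartanP Z : cartan T Z ->
  exists X Y, [/\ lie_subalg T X, lie_subalg T Y & Z = cvec X Y].
Proof. by case=> tX tY; exists (re_vec Z), (im_vec Z); rewrite cvecK. Qed.

Lemma samelson_J2 : J *m J = - 1%:M.
Proof.
apply: cplx_inj => Z; rewrite map_mxM mulmxA.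
have -> : cplx (- 1%:M : 'M[R]_d) = - 1%:M by rewrite map_mxN map_mx1.
rewrite mulmxN mulmx1; move: Z; apply: root_ind.
- by move=> Z W hZ hW; rewrite !mulmxDl hZ hW opprD.
- move=> Z /cartanP[X [Y [tX tY ->]]].
  by rewrite !cvec_mulmx cvecN (Jt tX).2 (Jt tY).2.
- move=> a Z ra rZ; have [[_ e]|[_ e]] := J_root ra rZ.
    by rewrite e -scalemxAl e scalerA ii2 scaleN1r.
  by rewrite e -scalemxAl e scalerA mulrNN ii2 scaleN1r.
Qed.

(** [Ad t] fixes the torus algebra pointwise, so it preserves the joint
    eigenspaces of its bracket action. *)
Lemma root_space_Ad t (a : weight T) Z : T t -> root_space a Z ->
  root_space a (Z *m cplx (Adm t)).
Proof.
move=> Tt rZ H; rewrite (brC_Ad _ (Ad_torus Ttorus Tt _)) ?rZ ?scalemxAl //.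
exact: set_valP H.
Qed.

(** On the Cartan part [Ad t] is the identity, and on each root space [J] is a
    scalar. *)
Lemma Ad_J t : T t -> Adm t *m J = J *m Adm t.
Proof.
move=> Tt; apply: cplx_inj => Z; rewrite !map_mxM !mulmxA; move: Z.
apply: root_ind.
- by move=> Z W hZ hW; rewrite !mulmxDl hZ hW.
- move=> Z /cartanP[X [Y [tX tY ->]]].
  have A V : lie_subalg T V -> V *m Adm t = V.
    by move=> tV; apply: etrans (mul_Adm _ _) _; exact: Ad_torus Ttorus Tt tV.
  rewrite !cvec_mulmx; congr cvec.
    by rewrite (A X tX) (A _ (Jt tX).1).
  by rewrite (A Y tY) (A _ (Jt tY).1).
- move=> a Z ra rZ; have rA := root_space_Ad Tt rZ.
  case: Ppos => _ _ Pn _.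
  have [[Pa e]|[Pa e]] := J_root ra rZ.
    by rewrite (Jp Pa rA) e scalemxAl.
  have rA' : root_space (\- (\- a)) (Z *m cplx (Adm t)) by rewrite weight_oppK.
  by rewrite (Jn Pa rA') e scaleNr mulNmx scalemxAl.
Qed.

Section Integrability.
Hypothesis anti : forall u v, br u v = - br v u.

(* the Nijenhuis tensor on the complexification *)
Let NC Z W := brC (Z *m cplx J) (W *m cplx J) - brC Z W
  - (brC (Z *m cplx J) W + brC Z (W *m cplx J)) *m cplx J.

Let NCDl Z Z' W : NC (Z + Z') W = NC Z W + NC Z' W.
Proof.
have sub3 (p p' q q' r r' : 'rV[R[i]]_d) :
    p + p' - (q + q') - (r + r') = (p - q - r) + (p' - q' - r').
  by rewrite !opprD (addrACA p) [LHS]addrACA.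
rewrite /NC (mulmxDl Z Z') !brCDl.
move: (brC (Z *m cplx J) (W *m cplx J)) (brC (Z' *m cplx J) (W *m cplx J)).
move: (brC Z W) (brC Z' W) (brC (Z *m cplx J) W) (brC (Z' *m cplx J) W).
move: (brC Z (W *m cplx J)) (brC Z' (W *m cplx J)) => c e q q' a b p p'.
by rewrite (addrACA a) (mulmxDl (a + c)) sub3.
Qed.

Let NC_anti Z W : NC W Z = - NC Z W.
Proof.
have bA := fun Z1 W1 => brC_anti Z1 W1 anti.
rewrite /NC (bA (W *m cplx J) (Z *m cplx J)) (bA W Z) (bA (W *m cplx J) Z).
rewrite (bA W (Z *m cplx J)).
move: (brC (Z *m cplx J) (W *m cplx J)) (brC Z W).
move: (brC Z (W *m cplx J)) (brC (Z *m cplx J) W) => a b p q.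
by rewrite -(opprD a b) mulNmx !opprD !opprK (addrC a b).
Qed.

Let brC_cartan_root Z (a : weight T) W : cartan T Z -> root_space a W ->
  exists c, brC Z W = c *: W.
Proof.
move=> /cartanP[X [Y [tX tY ->]]] rW.
have hX : exists c, brC (cvec X 0) W = c *: W.
  by exists (a (SigSub (mem_set tX))); rewrite -rW.
have hY : exists c, brC (cvec Y 0) W = c *: W.
  by exists (a (SigSub (mem_set tY))); rewrite -rW.
have [c hc] := hX; have [c' hc'] := hY.
exists (c + ii * c'); rewrite scalerDl -scalerA -hc -hc' -brCZl -brCDl.
congr (brC _ W); rewrite cvecZ cvecD; congr cvec; rewrite /= ?scale0r ?scale1r ?scaler0.
  by rewrite subr0 addr0.
by rewrite !add0r.
Qed.

Let cartanJ Z : cartan T Z -> cartan T (Z *m cplx J).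
Proof.
by case=> tX tY; split; rewrite ?re_vec_mulmx ?im_vec_mulmx; apply: (Jt _).1.
Qed.

Let brC_cartan Z W : cartan T Z -> cartan T W -> brC Z W = 0.
Proof.
move=> /cartanP[X [Y [tX tY ->]]] /cartanP[X' [Y' [tX' tY' ->]]].
have ab := lie_subalg_abelian Ttorus.
rewrite brC_cvec (ab _ _ tX tX') (ab _ _ tY tY') (ab _ _ tX tY') (ab _ _ tY tX').
by rewrite subr0 addr0; apply/rowP => j; rewrite !mxE.
Qed.

Let NC_cartan_root Z (a : weight T) W : cartan T Z -> is_root a ->
  root_space a W -> NC Z W = 0.
Proof.
move=> cZ ra rW.
have [c hc] := brC_cartan_root cZ rW.
have [c' hc'] := brC_cartan_root (cartanJ cZ) rW.
have [s e s2] : exists2 s, W *m cplx J = s *: W & s * s = -1.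
  have [[_ e]|[_ e]] := J_root ra rW; first by exists ii.
  by exists (- ii) => //; rewrite mulrNN ii2.
rewrite /NC e !brCZr hc hc' mulmxDl -!scalemxAl e !scalerA -!scalerDl -!scalerBl.
apply/eqP; rewrite scaler_eq0; apply/orP; left; apply/eqP.
apply: (@etrans _ _ (- c - c * (s * s))).
  by rewrite /GRing.scale /=; ring.
by rewrite s2; ring.
Qed.

Let root_spaceD (a b : weight T) Z W : root_space a Z -> root_space b W ->
  root_space (a \+ b) (brC Z W).
Proof.
move=> rZ rW H; rewrite brC_leibniz rZ rW brCZl brCZr -scalerDl //.
Qed.

Let addK (a b : weight T) : (a \+ b) \+ (\- a) = b.
Proof. by apply/funext => H /=; rewrite addrAC subrr add0r. Qed.

Let NC_root_root (a b : weight T) Z W : is_root a -> is_root b ->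
  root_space a Z -> root_space b W -> NC Z W = 0.
Proof.
move=> ra rb rZ rW; case: Ppos => Proot Ptot Pn Padd.
have same s : s * s = -1 -> Z *m cplx J = s *: Z -> W *m cplx J = s *: W ->
    brC Z W *m cplx J = s *: brC Z W -> NC Z W = 0.
  move=> s2 eZ eW e; rewrite /NC eZ eW !brCZl !brCZr mulmxDl -!scalemxAl e.
  by rewrite !scalerA s2 !scaleN1r subrr.
have opp s : s * s = -1 -> Z *m cplx J = s *: Z -> W *m cplx J = - s *: W ->
    NC Z W = 0.
  move=> s2 eZ eW; rewrite /NC eZ eW !brCZl !brCZr scalerA mulrN s2 opprK.
  by rewrite scale1r subrr scaleNr subrr mul0mx subrr.
have [e0|e0] := eqVneq (brC Z W) 0.
  have z s : brC Z W *m cplx J = s *: brC Z W by rewrite e0 mul0mx scaler0.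
  have [[Pa eZ]|[Pa eZ]] := J_root ra rZ; have [[Pb eW]|[Pb eW]] := J_root rb rW.
  - exact: (same ii).
  - exact: (opp ii).
  - by apply: (opp (- ii)); rewrite ?mulrNN ?opprK.
  - by apply: (same (- ii)); rewrite ?mulrNN.
have rZW := root_spaceD rZ rW.
have rab : (exists H, (a \+ b) H != 0) -> is_root (a \+ b).
  by move=> h; split => //; exists (brC Z W).
have nz : ~ (exists H, (a \+ b) H != 0) -> b = \- a.
  move=> h; apply/funext => H /=; apply/eqP; rewrite -addr_eq0 addrC.
  by apply/negP => /negP ab; apply: h; exists H.
have [[Pa eZ]|[Pa eZ]] := J_root ra rZ; have [[Pb eW]|[Pb eW]] := J_root rb rW.
- have [/rab rab'|/nz ba] := pselect (exists H, (a \+ b) H != 0).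
    by apply: (same ii) => //; apply: (Jp (Padd _ _ Pa Pb rab')).
  by exfalso; apply: (Pn a); rewrite -ba.
- exact: (opp ii).
- by apply: (opp (- ii)); rewrite ?mulrNN ?opprK.
- have [/rab rab'|/nz ba] := pselect (exists H, (a \+ b) H != 0); last first.
    by exfalso; apply: (Pn (\- a)); rewrite {2}(esym ba).
  apply: (same (- ii)) => //; first by rewrite mulrNN.
  (* if the sum of two negative roots were positive, adding a positive root to
     it would make a negative root positive *)
  have [Pab|Pab] := Ptot _ rab'.
    exfalso; apply: (Pn b); split => //.
    by have := Padd _ _ Pab Pa; rewrite addK; apply.
  rewrite scaleNr; apply: (Jn Pab); rewrite weight_oppK //.
Qed.

(** Vanishing of the Nijenhuis tensor.  It is complex bilinear, so it is enough to
    evaluate it on Cartan vectors and root vectors.  A Cartan vector acts on a root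
    vector by a scalar.  For two root vectors on which [J] acts by the same scalar
    the bracket is zero or is a root vector of the same sign, because positive roots
    are closed under addition; for opposite scalars the terms cancel. *)
Lemma samelson_integrable u v :
  br u (v *m J) - br (u *m J) (v *m J *m J) = (br u v - br (u *m J) (v *m J)) *m J.
Proof.
have N0 Z W : NC Z W = 0.
  have NCDr Z1 W1 W2 : NC Z1 (W1 + W2) = NC Z1 W1 + NC Z1 W2.
    apply: etrans (NC_anti (W1 + W2) Z1) _.
    apply: etrans (congr1 -%R (NCDl W1 W2 Z1)) _; rewrite opprD.
    by congr (_ + _); apply: esym; exact: NC_anti.
  have Nc Z1 W1 : cartan T Z1 -> NC Z1 W1 = 0.
    move=> cZ; move: W1; apply: root_ind.
    - by move=> W1 W2 h1 h2; rewrite NCDr h1 h2 addr0.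
    - move=> W1 cW; rewrite /NC !brC_cartan ?subrr ?addr0 ?mul0mx ?subrr //;
        exact: cartanJ.
    - by move=> a W1; exact: NC_cartan_root.
  move: Z W; apply: root_ind.
  - by move=> Z1 Z2 h1 h2 W; rewrite NCDl h1 h2 addr0.
  - by move=> Z1 cZ W; exact: Nc.
  - move=> a Z ra rZ; apply: root_ind.
    + by move=> W1 W2 h1 h2; rewrite NCDr h1 h2 addr0.
    + by move=> W1 cW; rewrite NC_anti Nc ?oppr0.
    + by move=> b W rb rW; exact: NC_root_root rZ rW.
have cJ x : cvec x 0 *m cplx J = cvec (x *m J) 0 by rewrite cvec_mulmx mul0mx.
have b0 x y : re_vec (brC (cvec x 0) (cvec y 0)) = br x y.
  by rewrite brC_cvec0 re_cvec.
have reE (a b c e : 'rV[R[i]]_d) : a - b - (c + e) *m cplx J = 0 ->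
    re_vec a - re_vec b - (re_vec c + re_vec e) *m J = 0.
  move=> h; rewrite -re_vecD -re_vec_mulmx -!re_vecB h.
  by apply/rowP => j; rewrite !mxE.
have h (x x' y y' : 'rV[R[i]]_d) : x *m cplx J = x' -> y *m cplx J = y' ->
    re_vec (brC x' y') - re_vec (brC x y)
      - (re_vec (brC x' y) + re_vec (brC x y')) *m J = 0.
  by move=> <- <-; apply: reE; exact: N0.
have h' (a b c e : 'rV[R]_d) :
    re_vec (brC (cvec (u *m J) 0) (cvec (v *m J) 0)) = a ->
    re_vec (brC (cvec u 0) (cvec v 0)) = b ->
    re_vec (brC (cvec (u *m J) 0) (cvec v 0)) = c ->
    re_vec (brC (cvec u 0) (cvec (v *m J) 0)) = e -> a - b - (c + e) *m J = 0.
  by move=> <- <- <- <-; exact: h (cJ u) (cJ v).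
have := h' _ _ _ _ (b0 (u *m J) (v *m J)) (b0 u v) (b0 (u *m J) v) (b0 u (v *m J)).
have mJJ (x : 'rV[R]_d) : x *m J *m J = - x by rewrite -mulmxA samelson_J2 mulmxN mulmx1.
have e1 : br (u *m J) (v *m J *m J) = - br (u *m J) v.
  exact: etrans (congr1 (br (u *m J)) (mJJ v)) (brNr G v (u *m J)).
move=> H; apply: etrans (congr1 (fun z => br u (v *m J) - z) e1) _; move: H.
move: (br (u *m J) (v *m J)) (br u v) (br (u *m J) v) (br u (v *m J)) => a b c e.
move=> /eqP; rewrite subr_eq0 => /eqP ab.
by rewrite opprK -[b - a]opprB ab mulNmx mJJ opprK addrC.
Qed.
End Integrability.
End Samelson.

(** * Estimates, closed conditions and left-invariant connections *)

Section MatrixBounds.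
Variable R : realType.

Lemma mulmx_bound m n p (A : 'M[R]_(m, n)) (B : 'M[R]_(n, p)) a b :
  (forall i j, `|A i j| <= a) -> (forall i j, `|B i j| <= b) ->
  forall i j, `|(A *m B) i j| <= n%:R * (a * b).
Proof.
move=> hA hB i j; rewrite mxE (le_trans (ler_norm_sum _ _ _)) //.
have -> : n%:R * (a * b) = \sum_(k < n) a * b.
  by rewrite sumr_const card_ord -[in RHS]mulr_natl.
by apply: ler_sum => k _; rewrite normrM; exact: ler_pM.
Qed.

Lemma mx_bounded m n (A : 'M[R]_(m, n)) : exists C, forall i j, `|A i j| <= C.
Proof.
exists (\sum_i \sum_j `|A i j|) => i j.
rewrite (bigD1 i) //= (bigD1 j) //= -addrA lerDl.
by rewrite addr_ge0 // sumr_ge0 // => k _; rewrite ?sumr_ge0.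
Qed.

Lemma sqnE n (v : 'rV[R]_n) : sqn v = bilin 1%:M v v.
Proof.
by rewrite /bilin mulmx1 mxE; apply: eq_bigr => j _; rewrite !mxE expr2.
Qed.

(** Evaluate [h >= 0] on [k u - u g]: with [g(u, u) <= k |u|^2] this
    quadratic expression forces [k h(u, u) >= |u|^2]. *)
Lemma dual_form_bound d (g h : 'M[R]_d) : g *m h = 1%:M -> g^T = g ->
  (forall u, 0 <= bilin g u u) ->
  exists2 e, 0 < e & forall u, e * sqn u <= bilin h u u.
Proof.
move=> gh gT gpos.
have hg : h *m g = 1%:M by exact: mulmx1C.
have hT : h^T = h.
  have e : h^T *m g = 1%:M by rewrite -{1}gT -trmx_mul gh trmx1.
  by rewrite -[LHS]mulmx1 -gh mulmxA e mul1mx.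
have hpos u : 0 <= bilin h u u.
  suff -> : bilin h u u = bilin g (u *m h) (u *m h) by exact: gpos.
  by rewrite bilin_mulmxl bilin_mulmxr hT hg mul1mx.
have [C hC] := mx_bounded g.
pose c := d%:R * (d%:R * C) ^+ 2.
have gle u : bilin g u u <= (c + 1) * sqn u.
  have h1 := sqn_mulmx u hC; rewrite -/c in h1.
  have h2 : bilin g u u = bilin 1%:M (u *m g) u.
    by rewrite bilin_mulmxl mulmx1.
  have h3 := sqn_ge0 (u *m g - u).
  have h4 : sqn (u *m g - u) = sqn (u *m g) + sqn u - 2 * bilin g u u.
    rewrite h2 !sqnE !(bilinDl, bilinNl, bilinDr, bilinNr).
    have -> : bilin 1%:M u (u *m g) = bilin 1%:M (u *m g) u.
      by rewrite bilin_mulmxl bilin_mulmxr gT mulmx1 mul1mx.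
    by ring.
  have h5 : 0 <= c * sqn u.
    by apply: mulr_ge0 (sqn_ge0 u); apply: mulr_ge0 => //; exact: sqr_ge0.
  have h6 := sqn_ge0 u.
  by rewrite mulrDl mul1r; lra.
have k0 : 0 < c + 1 by rewrite ltr_wpDl // mulr_ge0 // sqr_ge0.
exists (c + 1)^-1; first by rewrite invr_gt0.
move=> u; have := hpos ((c + 1) *: u - u *m g).
have -> : bilin h ((c + 1) *: u - u *m g) ((c + 1) *: u - u *m g) =
    (c + 1) ^+ 2 * bilin h u u - 2 * (c + 1) * sqn u + bilin g u u.
  rewrite !(bilinDl, bilinNl, bilinDr, bilinNr, bilinZl, bilinZr) sqnE.
  rewrite !(bilin_mulmxl, bilin_mulmxr) gT gh hg ?mul1mx ?mulmx1.
  by ring.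
have := gle u; set b := bilin g u u; set a := bilin h u u; set s := sqn u.
set k := c + 1 => h1 h2; rewrite mulrC ler_pdivrMr //.
have h3 : k * s <= k * (a * k) by lra.
by rewrite ler_pM2l in h3.
Qed.

Lemma closed_linear_ge n (f : 'rV[R]_n -> R) c :
  (forall k u v, f (k *: u + v) = k * f u + f v) -> closed [set v | c <= f v].
Proof.
move=> lf; have cf : continuous f.
  move=> v; have hd : is_diff v f f by apply: (@is_diff_linear_fun _ _ R^o).
  by apply: differentiable_continuous; exact: ex_diff.
exact: (proj1 (continuous_closedP f) cf _ (@closed_ge R c)).
Qed.

Lemma closed_linear_eq0 n (f : 'rV[R]_n -> R) :
  (forall k u v, f (k *: u + v) = k * f u + f v) -> closed [set v | f v = 0].
Proof.
move=> lf.
have -> : [set v | f v = 0] = [set v | 0 <= f v] `&` [set v | 0 <= - f v].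
  apply/seteqP; split => v /= => [->|[h1 h2]]; first by rewrite oppr0 lexx.
  by apply/eqP; rewrite eq_le h1 andbT -oppr_ge0.
apply: closedI; apply: closed_linear_ge => // k u v; rewrite lf; ring.
Qed.

End MatrixBounds.

Section LieAlgebra.
Variables (R : realType) (d : nat) (G : lieGroupType R d).
#[local] Opaque lie_bracket.

Lemma adm_linear : linear (@adm R d G).
Proof.
move=> k u v; apply/row_matrixP => i; rewrite !rowE [RHS]mulmxDr -scalemxAr.
apply: etrans (mul_adm G _ _) _; rewrite lie_bracket_linearl.
by congr (_ + _); last (apply: esym; exact: mul_adm);
  apply: congr1; apply: esym; exact: mul_adm.
Qed.

Lemma adm_leibniz u v :
  adm G (v *m adm G u) = adm G v *m adm G u - adm G u *m adm G v.
Proof.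
have mE x y : y *m adm G x = lie_bracket G x y by exact: mul_adm.
apply/row_matrixP => i; rewrite !rowE mulmxBr !mulmxA.
move: (delta_mx _ _) => w.
apply: etrans (mE _ _) _; apply: etrans (congr1 (fun z => lie_bracket G z w) (mE _ _)) _.
have e1 : w *m adm G v *m adm G u = lie_bracket G u (lie_bracket G v w).
  exact: etrans (mE _ _) (congr1 (lie_bracket G u) (mE _ _)).
have e2 : w *m adm G u *m adm G v = lie_bracket G v (lie_bracket G u w).
  exact: etrans (mE _ _) (congr1 (lie_bracket G v) (mE _ _)).
apply: etrans _ (esym (etrans (congr1 (fun z => z - _) e1) (congr1 (fun z => _ - z) e2))).
by apply/eqP; rewrite eq_sym subr_eq; apply/eqP; exact: lie_bracket_leibniz.
Qed.

Lemma Adm_adm (t : G) u : Adm t *m adm G (u *m Adm t) = adm G u *m Adm t.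
Proof.
apply/row_matrixP => i; rewrite !rowE !mulmxA; move: (delta_mx _ _) => w.
apply: etrans (mul_adm G _ _) _.
apply: etrans (congr2 (lie_bracket G) (mul_Adm t u) (mul_Adm t w)) _.
apply: etrans (esym (Ad_bracket t u w)) _.
apply: etrans (esym (mul_Adm t _)) _.
exact: (congr1 (fun z : 'rV[R]_d => z *m Adm t) (esym (mul_adm G u w))).
Qed.

Lemma Adm1 : Adm (1%g : G) = 1%:M.
Proof.
apply/row_matrixP => i; rewrite !rowE mulmx1.
by apply: etrans (mul_Adm _ _) _; exact: Ad1.
Qed.

Lemma AdmV (t : G) : Adm t *m Adm t^-1%g = 1%:M.
Proof. by apply: etrans (esym (AdmM t^-1%g t)) _; rewrite mulVg; exact: Adm1. Qed.

Lemma smooth_cst (W : normedModType R) (c : W) : smooth_field (fun _ : G => c).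
Proof.
move=> a k; elim: k c => [|k IH] c /=; first by move=> x _; exact: cst_continuous.
split=> [x _|v]; first exact: differentiable_cst.
have -> : (fun x : 'rV[R]_d => 'd (fun=> c) x v) = (fun=> 0).
  by apply/funext => x; exact: (congr1 (@^~ v) (diff_cst c x)).
exact: IH.
Qed.

Lemma nabla_cst (Gamma : connection G) u w x :
  nabla Gamma u (cst w) x = w *m Gamma x u.
Proof. by apply: etrans (congr1 (fun z => z + _) (dfun_cst w x u)) (add0r _). Qed.

Lemma lin1_mx_mulmx (M : 'M[R]_d) : lin1_mx (fun w => w *m M) = M.
Proof. by apply/row_matrixP => i; rewrite !rowE; exact: (mul_rV_lin1 (mulmxr M)). Qed.

(** For a left-invariant connection that commutes with [J], the commutator part
    of the curvature has trace zero against [J], which leaves the term of the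
    bracket. *)
Lemma ricci_left_invariant (Gamma : connection G) (I : G -> 'M[R]_d)
    (F : {linear 'rV[R]_d -> 'M[R]_d}) (J : 'M[R]_d) x u v :
  (forall y w, Gamma y w = F w) -> (forall y, I y = J) ->
  (forall w, J *m F w = F w *m J) ->
  ricci_form Gamma I x u v = 2^-1 * \tr (F (lie_bracket G u v) *m J).
Proof.
move=> GF IJ JF; rewrite /ricci_form.
have nc w z y : nabla Gamma w (cst z) y = z *m F w by rewrite nabla_cst GF.
have nn w z p y : nabla Gamma w (nabla Gamma z (cst p)) y = p *m F z *m F w.
  have -> : nabla Gamma z (cst p) = cst (p *m F z) by apply/funext => q; exact: nc.
  exact: nc.
have -> : (fun w => curvature Gamma x u v w *m I x) =
    (fun w => w *m ((F v *m F u - F u *m F v - F (lie_bracket G u v)) *m J)).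
  apply/funext => w; rewrite /curvature !nn nc IJ !mulmxA; congr (_ *m J).
  by rewrite !mulmxBr !mulmxA.
rewrite lin1_mx_mulmx !mulmxBl.
have trB (X Y : 'M[R]_d) : \tr (X - Y) = \tr X - \tr Y by exact: linearB.
rewrite !trB.
have -> : \tr (F u *m F v *m J) = \tr (F v *m F u *m J).
  by rewrite -mulmxA -JF mulmxA mxtrace_mulC mulmxA.
by rewrite subrr sub0r mulrN opprK.
Qed.

End LieAlgebra.

(** * The invariant inverse metric *)

Section InvariantBivector.
Variables (R : realType) (d : nat) (ad : {linear 'rV[R]_d -> 'M[R]_d}).
Variables (J : 'M[R]_d) (S : set 'M[R]_d) (C : R).
Hypotheses (S1 : S 1%:M) (SM : forall A B, S A -> S B -> S (A *m B))
  (SV : forall A, S A -> exists2 B, S B & A *m B = 1%:M)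
  (SC : forall A, S A -> forall i j, `|A i j| <= C)
  (SJ : forall A, S A -> A *m J = J *m A)
  (Sad : forall A, S A -> forall u, A *m ad (u *m A) = ad u *m A).

Let conjm (A : 'M[R]_d) : 'M[R]_(d * d) := lin_mx (mulmxr A \o mulmx A^T).

Let conjmE A v : vec_mx (v *m conjm A) = A^T *m vec_mx v *m A.
Proof. by rewrite mul_rV_lin mxvecK. Qed.

Let conjm_bounded A i j : S A -> `|conjm A i j| <= d%:R * (d%:R * (C * 1) * C).
Proof.
move=> SA; case/mxvec_indexP: j => k l; case/mxvec_indexP: i => p q.
have -> : conjm A (mxvec_index p q) (mxvec_index k l) =
    (A^T *m delta_mx p q *m A) k l.
  rewrite -[delta_mx p q]vec_mx_delta -conjmE [RHS]mxE -rowE.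
  by rewrite [RHS]mxE.
apply: mulmx_bound; last exact: SC.
apply: mulmx_bound => i j; first by rewrite mxE; exact: SC.
by rewrite mxE; case: (_ && _); rewrite ?normr1 ?normr0.
Qed.

(** A fixed point of the congruence action of [S] on matrices, in the closed convex
    set of symmetric, [J]-invariant, defect-free matrices that dominate a fixed
    multiple of the identity along the whole [S]-orbit.  The last condition keeps
    the fixed point invertible. *)
Lemma invariant_bivector h0 e0 :
  h0^T = h0 -> J^T *m h0 *m J = h0 -> cyt_defect ad J h0 = 0 ->
  0 < e0 -> (forall u, e0 * sqn u <= bilin h0 u u) ->
  exists h, [/\ h^T = h, J^T *m h *m J = h, cyt_defect ad J h = 0,
    (exists2 e, 0 < e & forall u, e * sqn u <= bilin h u u) &
    forall A, S A -> A^T *m h *m A = h].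
Proof.
move=> h0T h0J h0d e0p h0p.
pose c := d%:R * (d%:R * C) ^+ 2.
have c0 : 0 <= c by apply: mulr_ge0 => //; exact: sqr_ge0.
have k0 : 0 < c + 1 by rewrite ltr_wpDl.
(* [c] bounds the squared norms of the elements of [S] and of their inverses *)
pose e := e0 / (c + 1).
have ep : 0 < e by rewrite divr_gt0.
have bE (h A : 'M[R]_d) u : bilin (A^T *m h *m A) u u = bilin h (u *m A^T) (u *m A^T).
  by rewrite bilin_mulmxl bilin_mulmxr trmxK.
pose K1 := [set v : 'rV[R]_(d * d) | forall p : 'I_d * 'I_d,
  [set: 'I_d * 'I_d] p -> vec_mx v p.1 p.2 - vec_mx v p.2 p.1 = 0].
pose K2 := [set v : 'rV[R]_(d * d) | forall p : 'I_d * 'I_d,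
  [set: 'I_d * 'I_d] p -> (J^T *m vec_mx v *m J - vec_mx v) p.1 p.2 = 0].
pose K3 := [set v : 'rV[R]_(d * d) | forall k : 'I_d,
  [set: 'I_d] k -> cyt_defect ad J (vec_mx v) 0 k = 0].
pose K4 := [set v : 'rV[R]_(d * d) | forall p : 'M[R]_d * 'rV[R]_d,
  [set p | S p.1] p -> e * sqn p.2 <= bilin (p.1^T *m vec_mx v *m p.1) p.2 p.2].
pose K := K1 `&` K2 `&` K3 `&` K4.
have K1P v : K1 v <-> (vec_mx v)^T = vec_mx v.
  split=> [h|h p _]; last by rewrite -{1}h mxE subrr.
  apply/matrixP => i j; rewrite mxE; apply/eqP; rewrite -subr_eq0; apply/eqP.
  exact: (h (j, i)).
have K2P v : K2 v <-> J^T *m vec_mx v *m J = vec_mx v.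
  split=> [h|h p _]; last by rewrite h subrr mxE.
  apply/eqP; rewrite -subr_eq0; apply/eqP/matrixP => i j.
  by rewrite (h (i, j) I) mxE.
have K3P v : K3 v <-> cyt_defect ad J (vec_mx v) = 0.
  split=> [h|h p _]; last by rewrite h mxE.
  by apply/rowP => k; rewrite (h k I) mxE.
have vl (k : R) (u v : 'rV[R]_(d * d)) :
  vec_mx (k *: u + v) = k *: vec_mx u + vec_mx v by rewrite linearP.
have K1c : closed K1.
  apply: closed_bigI => p _; apply: closed_linear_eq0 => k u v.
  by rewrite vl !mxE; ring.
have K2c : closed K2.
  apply: closed_bigI => p _; apply: closed_linear_eq0 => k u v.
  rewrite vl mulmxDr mulmxDl -scalemxAr -scalemxAl.
  move: (J^T *m _ *m J) (J^T *m _ *m J) => a b.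
  by rewrite !mxE; ring.
have K3c : closed K3.
  apply: closed_bigI => k _; apply: closed_linear_eq0 => c' u v.
  by rewrite vl cyt_defectD cyt_defectZ !mxE.
have bl (A : 'M[R]_d) w k u v :
    bilin (A^T *m vec_mx (k *: u + v) *m A) w w =
    k * bilin (A^T *m vec_mx u *m A) w w + bilin (A^T *m vec_mx v *m A) w w.
  rewrite vl !bE /bilin mulmxDr mulmxDl mxE -scalemxAr -scalemxAl.
  by rewrite [X in X + _ = _]mxE.
have K4c : closed K4.
  apply: closed_bigI => p _; apply: closed_linear_ge => k u v.
  exact: bl.
have Kc : closed K by do 3!apply: closedI => //.
have half (V : lmodType R) (x y : V) : 2^-1 *: (x + y) = 2^-1 *: x + 2^-1 *: y.
  by rewrite scalerDr.
have Kmid u v : K u -> K v -> K (2^-1 *: (u + v)).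
  move=> [[[/K1P u1 /K2P u2] /K3P u3] u4] [[[/K1P v1 /K2P v2] /K3P v3] v4].
  have E : vec_mx (2^-1 *: (u + v)) = 2^-1 *: vec_mx u + 2^-1 *: vec_mx v.
    by rewrite half vl linearZ.
  split; [split; [split|]|].
  - by apply/K1P; rewrite E linearD !linearZ /= u1 v1.
  - apply/K2P; rewrite E mulmxDr mulmxDl -!scalemxAr -!scalemxAl u2 v2 //.
  - by apply/K3P; rewrite E cyt_defectD !cyt_defectZ u3 v3 !scaler0 addr0.
  - move=> p Sp; have := u4 p Sp; have := v4 p Sp.
    have -> : 2^-1 *: (u + v) = 2^-1 *: u + (2^-1 *: v + 0) by rewrite half addr0.
    rewrite !bl; have -> : bilin (p.1^T *m vec_mx 0 *m p.1) p.2 p.2 = 0.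
      by rewrite linear0 mulmx0 mul0mx /bilin mulmx0 mul0mx mxE.
    by move=> h1 h2; lra.
have KS M v : (conjm @` S) M -> K v -> K (v *m M).
  move=> [A SA <-] [[[/K1P u1 /K2P u2] /K3P u3] u4]; have AJ := SJ SA.
  split; [split; [split|]|].
  - by apply/K1P; rewrite conjmE !trmx_mul trmxK u1 mulmxA.
  - apply/K2P; rewrite conjmE -[RHS](congr1 (fun z => A^T *m z *m A) u2).
    by rewrite -!mulmxA AJ !mulmxA -!trmx_mul AJ.
  - apply/K3P; rewrite conjmE; have [B _ AB] := SV SA.
    by rewrite (cyt_defect_aut _ AB AJ (Sad SA)) u3 mul0mx.
  - move=> p Sp; rewrite conjmE.
    have := u4 (A *m p.1, p.2) (SM SA Sp).
    by rewrite /= trmx_mul !mulmxA.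
have K0 : K (mxvec h0).
  split; [split; [split|]|].
  - by apply/K1P; rewrite mxvecK.
  - by apply/K2P; rewrite mxvecK.
  - by apply/K3P; rewrite mxvecK.
  - move=> [A u] /= SA; rewrite mxvecK bE.
    apply: le_trans (h0p _); have [B SB AB] := SV SA.
    have h1 : sqn u <= c * sqn (u *m A^T).
      have bT i j : `|B^T i j| <= C by rewrite mxE; exact: SC.
      have := sqn_mulmx (u *m A^T) bT.
      by rewrite -mulmxA -trmx_mul (mulmx1C AB) trmx1 mulmx1.
    have h2 := sqn_ge0 (u *m A^T).
    rewrite /e mulrAC ler_pdivrMr // -mulrA ler_pM2l //.
    by rewrite mulrDr mulr1 mulrC; lra.
have S'1 : (conjm @` S) 1%:M.
  exists 1%:M => //; apply/row_matrixP => i; rewrite !rowE mulmx1.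
  by rewrite -[RHS]vec_mxK -[LHS]vec_mxK conjmE trmx1 mul1mx mulmx1.
have conjM A B : conjm A *m conjm B = conjm (A *m B).
  apply/row_matrixP => i; rewrite !rowE mulmxA.
  by rewrite -[RHS]vec_mxK -[LHS]vec_mxK !conjmE trmx_mul !mulmxA.
have S'M M N : (conjm @` S) M -> (conjm @` S) N -> (conjm @` S) (M *m N).
  move=> [A SA <-] [B SB <-]; exists (A *m B); first exact: SM.
  by rewrite conjM.
have conj1 : conjm 1%:M = 1%:M.
  apply/row_matrixP => i; rewrite !rowE mulmx1.
  by rewrite -[RHS]vec_mxK -[LHS]vec_mxK conjmE trmx1 mul1mx mulmx1.
have S'V M : (conjm @` S) M -> exists2 N, (conjm @` S) N & M *m N = 1%:M.
  move=> [A SA <-]; have [B SB AB] := SV SA.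
  by exists (conjm B); [exists B | rewrite conjM AB conj1].
have S'C M : (conjm @` S) M -> forall i j, `|M i j| <= d%:R * (d%:R * (C * 1) * C).
  by move=> [A SA <-] i j; exact: conjm_bounded.
have [v Kv vfix] := bounded_group_fixed_point S'1 S'M S'V S'C Kc Kmid KS K0.
exists (vec_mx v); case: Kv => [[[/K1P v1 /K2P v2] /K3P v3] v4]; split => //.
- exists e => // u; have := v4 (1%:M, u) S1.
  by rewrite /= trmx1 mul1mx mulmx1.
- by move=> A SA; rewrite -conjmE vfix //; exists A.
Qed.

End InvariantBivector.

(** * Passing from the Lie algebra to the group *)

Section Bismut.
Variables (R : realType) (d : nat) (G : lieGroupType R d).
#[local] Opaque lie_bracket Adm.
Variables (ad : {linear 'rV[R]_d -> 'M[R]_d}) (J : 'M[R]_d).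
Hypothesis adE : forall u v, v *m ad u = lie_bracket G u v.
Hypothesis leibniz : forall u v, ad (v *m ad u) = ad v *m ad u - ad u *m ad v.
Hypothesis killing_nondeg :
  forall u, (forall v, \tr (ad u *m ad v) = 0) -> u = 0.

Let anti : lie_antisymmetric ad := leibniz_antisymmetric leibniz killing_nondeg.

Lemma torsionE (Gamma : connection G) x u v :
  torsion Gamma x u v = v *m Gamma x u - u *m Gamma x v - v *m ad u.
Proof. by rewrite /torsion !nabla_cst adE. Qed.

Lemma bismut_connection_form (I g : G -> 'M[R]_d) g0 (Gamma : connection G) :
  (forall x, I x = J) -> (forall x, g x = g0) ->
  (forall u v, bilin g0 u v = bilin g0 v u) ->
  bismut_connection I g Gamma -> forall x, bismut_form ad g0 J (Gamma x).
Proof.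
move=> IJ gg gs [_ gm ge gt] x; split.
- move=> u v w; have := gm x u v w; rewrite !nabla_cst gg.
  have -> : (fun y => bilin (g y) v w) = (fun=> bilin g0 v w).
    by apply/funext => y; rewrite gg.
  rewrite dfun_cst (gs v) /triform => /esym/eqP.
  by rewrite addr_eq0 => /eqP.
- move=> u; apply/row_matrixP => i; rewrite !rowE !mulmxA.
  move: (delta_mx _ _) => v; have := ge x u v; rewrite nabla_cst IJ.
  have -> : (fun y => v *m I y) = cst (v *m J).
    by apply/funext => y; rewrite IJ.
  by rewrite nabla_cst.
- move=> u v w; have := gt x u v w; rewrite !torsionE gg /triform.
  by rewrite !(bilinDl, bilinNl).
Qed.

Lemma bismut_form_connection (I g : G -> 'M[R]_d) g0
    (F : {linear 'rV[R]_d -> 'M[R]_d}) :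
  (forall x, I x = J) -> (forall x, g x = g0) ->
  (forall u v, bilin g0 u v = bilin g0 v u) ->
  bismut_form ad g0 J F -> bismut_connection I g (fun _ => F).
Proof.
move=> IJ gg gs [fm fe ft]; split.
- by move=> u; exact: smooth_cst.
- move=> x u v w; rewrite !nabla_cst gg.
  have -> : (fun y => bilin (g y) v w) = (fun=> bilin g0 v w).
    by apply/funext => y; rewrite gg.
  rewrite dfun_cst (gs v); have := fm u v w; rewrite /triform => ->.
  by rewrite addNr.
- move=> x u v; rewrite nabla_cst IJ.
  have -> : (fun y => v *m I y) = cst (v *m J).
    by apply/funext => y; rewrite IJ.
  by rewrite nabla_cst -!mulmxA fe.
- move=> x u v w; rewrite !torsionE gg.
  by have := ft u v w; rewrite /triform !(bilinDl, bilinNl).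
Qed.

(** Uniqueness makes the Bismut connection of a left-invariant structure
    left-invariant, so its Ricci form is a trace evaluated on brackets; since
    brackets span the Lie algebra, it vanishes exactly when the trace does. *)
Lemma cyt_iff_defect (I g : G -> 'M[R]_d) g0 h0 :
  (forall x, I x = J) -> (forall x, g x = g0) -> hermitian_form g0 h0 J ->
  (forall u v : 'rV[R]_d, (v *m J) *m ad u - (v *m J *m J) *m ad (u *m J) =
    (v *m ad u - v *m J *m ad (u *m J)) *m J) ->
  cyt I g <-> cyt_defect ad J h0 = 0.
Proof.
move=> IJ gg hH integrable.
have gs := hf_sym hH.
split=> [[Gamma hB hr]|h0d].
  have hF := bismut_connection_form IJ gg gs hB.
  have GF x u : Gamma x u = Gamma 1%g u.
    exact: (bismut_form_unique hH (hF x) (hF 1%g)).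
  apply/(cyt_defect_trace anti hH (hF 1%g)).
  apply: (killing_perfect leibniz killing_nondeg).
    move=> k u v; rewrite linearP mulmxDl -scalemxAl.
    by rewrite linearD linearZ.
  move=> u v; rewrite adE; have := hr 1%g u v.
  rewrite (ricci_left_invariant 1%g u v GF IJ (bf_endo (hF 1%g))) => /eqP.
  by rewrite mulf_eq0 invr_eq0 pnatr_eq0 /= => /eqP.
have [F hF] := bismut_form_exists anti hH integrable.
exists (fun _ => F); first exact: bismut_form_connection IJ gg gs hF.
move=> x u v.
rewrite (@ricci_left_invariant _ _ _ _ _ F J x u v _ IJ (bf_endo hF)) //.
by rewrite ((cyt_defect_trace anti hH hF).2 h0d) mulr0.
Qed.

End Bismut.

Theorem proposition4p1 (R : realType) (d : nat) (G : lieGroupType R d)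
    (T : set G) (P : set (weight T)) (I g : G -> 'M[R]_d) :
  compact [set: G] -> semisimple G ->
  maximal_torus T -> root_space_decomposition T ->
  positive_system P -> samelson P I ->
  hermitian_metric I g -> left_invariant_metric g -> cyt I g ->
  exists g' : G -> 'M[R]_d,
    [/\ hermitian_metric I g', left_invariant_metric g', cyt I g' &
        right_T_invariant T g'].
Proof.
move=> _ ss [Ttorus _] rsd Ppos [Il Jt Jp Jn] [[_ gsym gpos] gI] gl gcyt.
have [ad admE] : exists ad : {linear 'rV[R]_d -> 'M[R]_d}, forall u, ad u = adm G u.
  pose lM := GRing.isLinear.Build _ _ _ _ _ (@adm_linear R d G).
  pose adL : {linear 'rV[R]_d -> 'M[R]_d} := HB.pack (@adm R d G) lM.
  by exists adL.
have adE u v : v *m ad u = lie_bracket G u v by rewrite admE; exact: mul_adm.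
have leibniz u v : ad (v *m ad u) = ad v *m ad u - ad u *m ad v.
  by rewrite !admE; exact: adm_leibniz.
have nondeg u : (forall v, \tr (ad u *m ad v) = 0) -> u = 0.
  by move=> h; apply: ss => v; have := h v; rewrite !admE.
have anti := leibniz_antisymmetric leibniz nondeg.
set J := I 1%g in Jt Jp Jn.
have IJ x : I x = J.
  apply/row_matrixP => i; rewrite !rowE; have := Il x 1%g (delta_mx 0 i).
  by rewrite !tmap_left mulg1.
set g0 := g 1%g.
have gg x : g x = g0.
  apply: bilin_inj => u v; have := gl x 1%g u v.
  by rewrite !tmap_left mulg1.
have J2 : J *m J = - 1%:M := samelson_J2 rsd Ppos Jt Jp Jn.
have brA u v : lie_bracket G u v = - lie_bracket G v u by rewrite -!adE.
have integrable (u v : 'rV[R]_d) : (v *m J) *m ad u - (v *m J *m J) *m ad (u *m J) =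
    (v *m ad u - v *m J *m ad (u *m J)) *m J.
  by rewrite !adE; exact: (samelson_integrable Ttorus rsd Ppos Jt Jp Jn brA).
have unit_pos (B : 'M[R]_d) : (forall u, u != 0 -> 0 < bilin B u u) -> B \in unitmx.
  move=> Bp; rewrite -row_free_unit -kermx_eq0; apply/eqP/row_matrixP => i.
  rewrite row0; apply/eqP; apply: contraT => /Bp.
  by rewrite /bilin -row_mul mulmx_ker row0 mul0mx mxE ltxx.
have gu : g0 \in unitmx by apply: unit_pos => u; exact: gpos.
pose h0 := invmx g0.
have hH : hermitian_form g0 h0 J.
  split=> //; [exact: gsym | exact: mulmxV |].
  by move=> u v; have := gI 1%g u v.
have h0d : cyt_defect ad J h0 = 0.
  exact/(cyt_iff_defect adE leibniz nondeg IJ gg hH integrable).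
have gnn u : 0 <= bilin g0 u u.
  have [->|u0] := eqVneq u 0; first by rewrite /bilin !mul0mx mxE.
  exact: ltW (gpos _ _ u0).
have [e0 e0p h0p] := dual_form_bound (hf_inv hH) (hform_gT hH) gnn.
have [[T1 TM TV] Tc _ Tab] := Ttorus.
have [C hC] := Adm_bounded Tc.
pose S := (@Adm R d G) @` T.
have S1 : S 1%:M by exists 1%g => //; exact: Adm1.
have SM A B : S A -> S B -> S (A *m B).
  by move=> [s Ts <-] [t Tt <-]; exists (t * s)%g; [exact: TM | exact: AdmM].
have SV A : S A -> exists2 B, S B & A *m B = 1%:M.
  move=> [t Tt <-]; exists (Adm t^-1%g); last exact: AdmV.
  by exists t^-1%g => //; exact: TV.
have SC A : S A -> forall i j, `|A i j| <= C by move=> [t Tt <-]; exact: hC.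
have SJ A : S A -> A *m J = J *m A.
  by move=> [t Tt <-]; exact: (Ad_J Ttorus rsd Ppos Jt Jp Jn Tt).
have Sad A : S A -> forall u, A *m ad (u *m A) = ad u *m A.
  by move=> [t Tt <-] u; rewrite !admE; exact: Adm_adm.
have [h [hT hJ hd [e ep hp] hS]] := invariant_bivector S1 SM SV SC SJ Sad
  (hform_hT hH) (hform_hI hH) h0d e0p h0p.
have hpos u : u != 0 -> 0 < bilin h u u.
  move=> u0; apply: lt_le_trans (hp u); rewrite mulr_gt0 // lt_neqAle sqn_ge0.
  by rewrite andbT eq_sym; apply: contra u0 => /eqP q0; rewrite [u]sqn_eq0 ?q0.
have hu := unit_pos h hpos.
pose g' := invmx h.
have g'T : g'^T = g' by rewrite /g' trmx_inv hT.
have g'h : g' *m h = 1%:M by exact: mulVmx.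
have hg' : h *m g' = 1%:M by exact: mulmxV.
(* an automorphism of the bivector is an automorphism of the dual form *)
have inv_form (A B : 'M[R]_d) : A *m B = 1%:M -> A^T *m h *m A = h ->
    A *m g' *m A^T = g'.
  move=> AB Ah; have e1 : A *m g' *m A^T *m h = 1%:M.
    rewrite -[LHS]mulmx1 -AB !mulmxA -[A *m g' *m A^T *m h *m A]mulmxA.
    rewrite -[_ *m (h *m A)]mulmxA [A^T *m (h *m A)]mulmxA Ah.
    by rewrite -[A *m g' *m h]mulmxA g'h mulmx1.
  by rewrite -[LHS]mulmx1 -hg' mulmxA e1 mul1mx.
have Jinv : J *m (- J) = 1%:M by rewrite mulmxN J2 opprK.
have g'J := inv_form J (- J) Jinv hJ.
have g'pos u : u != 0 -> 0 < bilin g' u u.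
  move=> u0; have -> : bilin g' u u = bilin h (u *m g') (u *m g').
    by rewrite bilin_mulmxl bilin_mulmxr g'T g'h mul1mx.
  apply: hpos; apply: contra u0 => /eqP z.
  by rewrite -[u]mulmx1 -g'h mulmxA z mul0mx.
have g's u v : bilin g' u v = bilin g' v u.
  rewrite /bilin -[RHS](congr1 (fun M : 'M[R]_1 => M 0 0) (trmxK _)) [RHS]mxE.
  by rewrite !trmx_mul trmxK g'T mulmxA.
have hH' : hermitian_form g' h J.
  split=> // u v; rewrite bilin_mulmxl bilin_mulmxr -[in RHS]g'J //.
exists (fun=> g'); split.
- split; first split.
  + exact: smooth_cst.
  + by move=> x; exact: g's.
  + by move=> x; exact: g'pos.
  + by move=> x u v; rewrite IJ; exact: hf_I hH' _ _.
- by move=> a x u v; rewrite !tmap_left.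
- apply/(cyt_iff_defect adE leibniz nondeg IJ _ hH' integrable) => //.
- move=> t Tt x u v; rewrite !tmap_right.
  have E w : Ad t^-1%g w = w *m Adm t^-1%g by apply: esym; exact: mul_Adm.
  have SA : S (Adm t^-1%g) by exists t^-1%g => //; exact: TV.
  have [B _ AB] := SV _ SA.
  rewrite !E bilin_mulmxl bilin_mulmxr.
  by rewrite (inv_form _ _ AB (hS _ SA)).
Qed.
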